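(* For $k\ge 13$ and $n\ge 18k$, $$f(n,k,3)=|\mathcal G(n,k)|=\binom{n-1}{k-1}-\binom{n-k}{k-1}-\binom{n-k-1}{k-1}+\binom{n-2k}{k-1}+\binom{n-k-2}{k-3}+3.$$
   Context: For a family $\mathcal F\subset\binom{[n]}{k}$, the covering number $\tau(\mathcal F)$ is the minimum size of a set $T\subset[n]$ with $T\cap F\ne\emptyset$ for all $F\in\mathcal F$. A family is intersecting if any two of its members intersect. Define $f(n,k,s)=\max\{|\mathcal F|:\mathcal F\subset\binom{[n]}{k}\text{ intersecting},\ \tau(\mathcal F)\ge s\}$. Let $[a,b]=\{a,a+1,\dots,b\}$, $\mathcal B=\{[2,k+1],\ \{2\}\cup[k+2,2k],\ \{3\}\cup[k+2,2k]\}$, $\mathcal A=\{A\in\binom{[n]}{k}: 1\in A,\ A\cap B\ne\emptyset\ \forall B\in\mathcal B\}$, and $\mathcal G(n,k)=\mathcal A\cup\mathcal B$ (an intersecting family with $\tau=3$ for $n\ge 2k$). *)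

(* Defs.v *)
(* Ground set [n] = {1,...,n} is modelled by 'I_n,
   where the ordinal i : 'I_n stands for the integer i+1. *)
From mathcomp Require Import all_boot all_order all_algebra.
Set Implicit Arguments. Unset Strict Implicit. Unset Printing Implicit Defensive.

Section Defs.
Variable n : nat.

(* the point a of [n] (empty set if a is not in [1,n]) *)
Definition pt (a : nat) : {set 'I_n} := [set i : 'I_n | i.+1 == a].

Definition itv (a b : nat) : {set 'I_n} := [set i : 'I_n | a <= i.+1 <= b].

Definition uniform (k : nat) (F : {set {set 'I_n}}) : bool :=
  [forall A in F, #|A| == k].

Definition intersecting (F : {set {set 'I_n}}) : bool :=
  [forall A in F, forall B in F, A :&: B != set0].

Definition is_cover (F : {set {set 'I_n}}) (T : {set 'I_n}) : bool :=
  [forall A in F, T :&: A != set0].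

(* covering number: minimum size of a transversal (n.+1 if none exists) *)
Definition tau (F : {set {set 'I_n}}) : nat :=
  \big[minn/n.+1]_(T : {set 'I_n} | is_cover F T) #|T|.

Definition f (k s : nat) : nat :=
  \max_(F : {set {set 'I_n}} | [&& uniform k F, intersecting F & s <= tau F]) #|F|.

Definition Bfam (k : nat) : {set {set 'I_n}} :=
  [set itv 2 k.+1; pt 2 :|: itv (k+2) (2*k); pt 3 :|: itv (k+2) (2*k)].

Definition Afam (k : nat) : {set {set 'I_n}} :=
  [set A : {set 'I_n} | [&& #|A| == k, pt 1 \subset A &
                          [forall B in Bfam k, A :&: B != set0]]].

Definition Gfam (k : nat) : {set {set 'I_n}} := Afam k :|: Bfam k.

End Defs.

(* Main.v *)
Require Import Defs.
From mathcomp Require Import all_boot all_order all_algebra.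
From mathcomp Require Import zify.
Set Implicit Arguments. Unset Strict Implicit. Unset Printing Implicit Defensive.

(* Shift the family down for as long as the covering number stays at least 3. Either
   a shift creates a 2-cover, and then the family has a 3-cover {a, b, c}, or the
   family becomes stable, and then for {a, b, c} = {1, 2, 3} the members missing
   {a, b, c} can be injected by reflection into the k-sets containing {a, b, c} that
   are not in the family. Split the family by its traces on {a, b, c}. The links A, B,
   C of the singletons are pairwise cross-intersecting, and each of them is
   cross-intersecting with the link D, E, G of the complementary pair.

   Reflecting prefixes gives the Hilton-Milner type bound for |B| + |E| unless |E| is
   small and |B| is large. If the bound holds for two of the three pairs, the third
   pair, say A and D, is bounded by listing the sets of A according to the first
   element of a fixed set that they meet; since {a, x} is never a cover, a second set
   avoiding that element must be met too, and the sum of the bounds is exactly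
   |G(n, k)|. If two of the pairs are exceptional, the whole family is smaller by a
   constant factor: shift again outside {a, b, c}, until the links are stable or
   all members avoiding one of a, b, c meet a common pair {i, j}. *)

(* [{set {set T}}] elaborates with a [reverse_coercion] that hides from [lia]
   that two cardinals are the same term. *)
Ltac slia := unfold reverse_coercion in *; lia.

(** * Stable families and reflection *)

Definition unif (T : finType) (p : nat) (P : {set {set T}}) :=
  forall A, A \in P -> #|A| = p.

Definition cross (T : finType) (P Q : {set {set T}}) :=
  forall A B, A \in P -> B \in Q -> A :&: B != set0.

Lemma crossC (T : finType) (P Q : {set {set T}}) : cross P Q -> cross Q P.
Proof. by move=> h A B hA hB; rewrite setIC; apply: h. Qed.

Definition stable (M : nat) (Q : {set {set 'I_M}}) :=
  forall A (i j : 'I_M), A \in Q -> i < j -> j \in A -> i \notin A ->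
    i |: A :\ j \in Q.

Section Reflection.
Variable M : nat.
Implicit Types (A B : {set 'I_M}) (P Q : {set {set 'I_M}}).

Definition pre l : {set 'I_M} := [set i : 'I_M | i < l].
Definition flip l A : {set 'I_M} := [set i | (i \in A) (+) (i < l)].
Definition cnt A l := #|A :&: pre l|.

Lemma card_pre l : l <= M -> #|pre l| = l.
Proof.
move=> le; rewrite -[RHS]card_ord.
have -> : pre l = [set widen_ord le i | i : 'I_l].
  apply/setP=> i; rewrite inE; apply/idP/imsetP => [h|[j _ ->]]; last exact: (ltn_ord j).
  by exists (Ordinal h) => //; apply: val_inj.
by rewrite card_imset // => i j /(congr1 val) /= /val_inj.
Qed.

Lemma card_preD A l : l <= M -> #|pre l :\: A| + cnt A l = l.
Proof. by move=> le; rewrite /cnt addnC setIC cardsID card_pre. Qed.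

Lemma card_flip A l : l <= M -> #|flip l A| + 2 * cnt A l = #|A| + l.
Proof.
move=> le; have := card_preD A le; have := cardsID (pre l) A; rewrite -/(cnt A l).
have -> : flip l A = (A :\: pre l) :|: (pre l :\: A).
  by apply/setP=> i; rewrite !inE; case: (i \in A); case: (i < l).
rewrite cardsU (_ : _ :&: _ = set0) ?cards0; first lia.
by apply/setP=> i; rewrite !inE; case: (i \in A); case: (i < l).
Qed.

Lemma cnt_flip_le A l m : l <= m -> m <= M -> cnt (flip m A) l + cnt A l = l.
Proof.
move=> lm mM; rewrite -[RHS](card_preD A (leq_trans lm mM)) {1}/cnt; congr (_ + _).
apply: eq_card => i; rewrite !inE; case: (ltnP i l) => h; last by rewrite !andbF.
by rewrite (leq_trans h lm) andbT; case: (i \in A).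
Qed.

Lemma cnt_flip_ge A l m : m <= l -> l <= M ->
  cnt (flip m A) l + 2 * cnt A m = m + cnt A l.
Proof.
move=> ml lM; have := card_flip (A :&: pre l) (leq_trans ml lM).
have -> : flip m (A :&: pre l) = flip m A :&: pre l.
  apply/setP=> i; rewrite !inE; case: (ltnP i l) => h; rewrite ?andbT ?andbF //.
  by rewrite ltnNge (leq_trans ml h).
have -> : cnt (A :&: pre l) m = cnt A m.
  apply: eq_card => i; rewrite !inE; case: (ltnP i m) => h; rewrite ?andbF //.
  by rewrite (leq_trans h ml) !andbT.
by rewrite -/(cnt _ l) -/(cnt A l); lia.
Qed.

Lemma cnt0 A : cnt A 0 = 0.
Proof. by apply/eqP; rewrite cards_eq0; apply/eqP/setP=> i; rewrite !inE andbF. Qed.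

Lemma cntM A : cnt A M = #|A|.
Proof. by apply: eq_card => i; rewrite !inE ltn_ord andbT. Qed.

Lemma cnt_mono A l m : l <= m -> cnt A l <= cnt A m.
Proof.
by move=> lm; apply/subset_leq_card/setIS/subsetP=> i; rewrite !inE => h; apply: leq_trans lm.
Qed.

(* Reflect [A] at the last moment where the flipped set has at most [p] elements,
   as in the reflection principle; if [p + #|A| <= M] the result has exactly [p]. *)
Definition refl p A := flip (\max_(l < M.+1 | #|flip l A| <= p) l) A.

Lemma reflP p A l0 : l0 <= M -> #|flip l0 A| <= p -> p + #|A| <= M ->
  exists L, [/\ refl p A = flip L A, l0 <= L <= M, #|flip L A| = p
    & forall l, L < l <= M -> p < #|flip l A|].
Proof.
move=> l0M hl0 hM.
have hi : Ordinal (l0M : l0 < M.+1) \in [pred l : 'I_M.+1 | #|flip l A| <= p] by [].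
have [|i hi' e] := @eq_bigmax_cond _ [pred l : 'I_M.+1 | #|flip l A| <= p] (@nat_of_ord _).
  by apply/card_gt0P; exists (Ordinal (l0M : l0 < M.+1)).
have hmax l : l <= M -> #|flip l A| <= p -> l <= i.
  move=> lM hl; rewrite -e.
  exact: (@leq_bigmax_cond _ [pred l : 'I_M.+1 | #|flip l A| <= p] (@nat_of_ord _) (Ordinal (lM : l < M.+1))).
have iM : i <= M by rewrite -ltnS ltn_ord.
have {}hi' : #|flip i A| <= p := hi'; move: (nat_of_ord i) iM e hi' hmax => {hi}i iM e hi' hmax.
exists i; split=> //.
- by congr (flip _ A); exact: e.
- by rewrite iM hmax.
- case: (ltnP i M) => h.
    have := card_flip A h; have := cnt_mono A (leqnSn i).
    have : p < #|flip i.+1 A| by rewrite ltnNge; apply/negP=> /(hmax _ h); rewrite ltnn.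
    have := card_flip A iM. lia.
  have e2 : i = M by lia.
  have := card_flip A (leqnn M); rewrite cntM; rewrite e2 in hi' *; lia.
- by move=> l /andP[il lM]; rewrite ltnNge; apply/negP => /(hmax l lM); lia.
Qed.

Lemma flipK l : involutive (flip l).
Proof. by move=> A; apply/setP=> i; rewrite !inE addbK. Qed.

Definition visits p A := exists2 l, l <= M & #|flip l A| <= p.

Lemma card_refl p A : visits p A -> p + #|A| <= M -> #|refl p A| = p.
Proof. by case=> l lM hl hM; have [L [-> _ ->]] := reflP lM hl hM. Qed.

Lemma refl_inj p q A B : visits p A -> visits p B -> #|A| = q -> #|B| = q ->
  p + q <= M -> refl p A = refl p B -> A = B.
Proof.
move=> [l lM hl] [m mM hm] hA hB hM.
have [L [-> /andP[_ LM] eL maxL]] := reflP lM hl (etrans (congr1 (fun x => p + x <= M) hA) hM).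
have [L' [-> /andP[_ LM'] eL' maxL']] := reflP mM hm (etrans (congr1 (fun x => p + x <= M) hB) hM).
move=> e.
have aux L1 L2 A1 A2 : #|A1| = q -> #|A2| = q -> L1 < L2 -> L2 <= M ->
    #|flip L1 A1| = p -> (forall l, L1 < l <= M -> p < #|flip l A1|) ->
    flip L1 A1 = flip L2 A2 -> False.
  move=> h1 h2 h12 h2M c1 m1 e12.
  have := m1 L2; rewrite h12 h2M => /(_ isT).
  have eA2 : A2 = flip L2 (flip L1 A1) by rewrite e12 flipK.
  have := card_flip A1 h2M.
  have := card_flip A1 (ltnW (leq_trans h12 h2M)).
  have := card_flip (flip L1 A1) h2M; rewrite -eA2.
  have := cnt_flip_ge A1 (ltnW h12) h2M; lia.
case: (ltngtP L L') => hL.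
- by case: (aux L L' A B).
- by case: (aux L' L B A).
- by rewrite -[A](flipK L) e hL flipK.
Qed.

Lemma visits_card Q p q : unif q Q -> (forall A, A \in Q -> visits p A) ->
  p + q <= M -> #|Q| <= 'C(M, p).
Proof.
move=> uQ vQ hM.
rewrite -(card_in_imset (f := refl p) (D := Q)); last first.
  move=> A B hA hB; exact: (refl_inj (vQ _ hA) (vQ _ hB) (uQ _ hA) (uQ _ hB) hM).
have := cards_draws [set: 'I_M] p; rewrite cardsT card_ord => <-.
apply/subset_leq_card/subsetP=> B /imsetP[A hA ->].
rewrite inE subsetT /=; apply/eqP; apply: card_refl; first exact: vQ.
by rewrite (uQ _ hA).
Qed.

(* If the prefix counts of [A] and [B] never add up to more than the prefix
   length, their common elements can be moved down in [A] one at a time. *)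
Lemma stable_dominated P Q A B : stable Q -> cross Q P -> A \in Q -> B \in P ->
  exists2 l, l <= M & l < cnt A l + cnt B l.
Proof.
move=> sQ cQP hA hB.
case: (boolP [exists l : 'I_M.+1, l < cnt A l + cnt B l]) => [/existsP[l hl]|].
  by exists l => //; rewrite -ltnS.
rewrite negb_exists => /forallP hle0; exfalso.
have {hle0} hle l : l <= M -> cnt A l + cnt B l <= l.
  by move=> lM; have := hle0 (Ordinal (lM : l < M.+1)); rewrite -leqNgt.
move: {2}#|A :&: B| (leqnn #|A :&: B|) => c.
elim: c => [|c IH] in A hA hle *.
  by rewrite leqn0 cards_eq0; apply/negP/cQP.
move=> hc.
have [x0 hx0] : exists x, x \in A :&: B by apply/set0Pn/cQP.
case: (arg_minnP (fun x : 'I_M => x : nat) hx0) => j hj jmin.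
have {}hj : j \in A :&: B := hj.
have [jA jB] := setIP hj.
have disj : forall i : 'I_M, i < j -> ~~ ((i \in A) && (i \in B)).
  move=> i ij; apply/negP=> h; have hi : i \in A :&: B by rewrite inE.
  by have := jmin i hi; rewrite leqNgt ij.
have cU : forall X : {set 'I_M}, #|X :&: pre j.+1| = (j \in X) + #|X :&: pre j|.
  move=> X; rewrite (cardsD1 j) !inE ltnS leqnn andbT; congr (_ + _).
  by apply: eq_card => i; rewrite !inE ltnS leq_eqVlt -val_eqE /=; case: (ltngtP i j) => //=; rewrite ?andbF.
have [i /andP[ij hi]] : exists i : 'I_M, (i < j) && (i \notin A :|: B).
  apply/existsP; apply: contraT; rewrite negb_exists => /forallP h.
  have : pre j \subset (A :&: pre j) :|: (B :&: pre j).
    apply/subsetP=> i; rewrite inE => ij; have := h i; rewrite ij /= negbK !inE ij.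
    by rewrite !andbT.
  move/subset_leq_card; rewrite card_pre ?(ltnW (ltn_ord j)) //.
  have := leq_of_leqif (leq_card_setU (A :&: pre j) (B :&: pre j)).
  have := hle j.+1 (ltn_ord j); rewrite /cnt !cU jA jB; lia.
rewrite inE negb_or in hi; case/andP: hi => iA iB.
apply: (IH (i |: A :\ j)); first exact: sQ.
- move=> l lM; case: (ltnP j l) => jl.
    suff -> : cnt (i |: A :\ j) l = cnt A l by apply: hle.
    rewrite /cnt (cardsD1 i) [in RHS](cardsD1 j) !inE eqxx jA jl (ltn_trans ij jl) /=.
    congr (_ + _); apply: eq_card => y; rewrite !inE.
    by case: eqP => [->|_]; case: eqP => //=; rewrite (negbTE iA) ?andbF.
  rewrite /cnt -cardsUI (_ : _ :&: (_ :&: _) = set0) ?cards0 ?addn0.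
    rewrite -[X in _ <= X](card_pre lM); apply/subset_leq_card/subsetP=> y.
    by rewrite !inE => /orP[/andP[]|/andP[]].
  apply/setP=> y; rewrite !inE; apply/negbTE/negP.
  move=> /andP[/andP[h1 h2] /andP[h3 _]].
  have yj : y < j by lia.
  have := disj y yj; rewrite h3 andbT.
  case/orP: h1 => [/eqP e|/andP[_ ->//]].
  by move: h3; rewrite e (negbTE iB).
- rewrite -ltnS; apply: leq_trans _ hc.
  rewrite [X in _ < X](cardsD1 j) hj add1n ltnS; apply/subset_leq_card/subsetP=> y.
  rewrite !inE => /andP[/orP[/eqP->|/andP[-> ->]] h] //.
  by rewrite h in iB.
Qed.
End Reflection.

(** * Counting and shifting *)

Section Counting.
Variable T : finType.
Implicit Types (U X Y : {set T}) (p : nat).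

Definition hits p U X : {set {set T}} :=
  [set Y : {set T} | [&& Y \subset U, #|Y| == p & Y :&: X != set0]].

Lemma card_hits p U X : X \subset U ->
  #|hits p U X| + 'C(#|U| - #|X|, p) = 'C(#|U|, p).
Proof.
move=> XU; rewrite -[in RHS]cards_draws -(cardsDS XU) -(cards_draws (U :\: X)).
rewrite -[RHS](cardsID (hits p U X)); congr (_ + _); apply: eq_card => Y; rewrite !inE.
  by case: (Y \subset U); case: (#|Y| == p); case: (_ != _).
rewrite subsetD -setI_eq0; case: (Y \subset U); case: (#|Y| == p);
  by rewrite //= ?negbK ?andbT ?andbF.
Qed.

Lemma card_hits2 p U X Y : X \subset U -> Y \subset U ->
  #|[set Z : {set T} | [&& Z \subset U, #|Z| == p, Z :&: X != set0 & Z :&: Y != set0]]|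
    + 'C(#|U| - #|X|, p) + 'C(#|U| - #|Y|, p)
  = 'C(#|U|, p) + 'C(#|U| - #|X :|: Y|, p).
Proof.
move=> XU YU; set S := [set Z | _ & _]; have XYU : X :|: Y \subset U by rewrite subUset XU.
have := card_hits p XU; have := card_hits p YU; have := card_hits p XYU.
have := cardsUI (hits p U X) (hits p U Y).
have -> : hits p U X :|: hits p U Y = hits p U (X :|: Y).
  apply/setP=> Z; rewrite !inE setIUr setU_eq0 negb_and.
  by case: (Z \subset U); case: (#|Z| == p).
have -> : hits p U X :&: hits p U Y = S.
  apply/setP=> Z; rewrite !inE.
  by case: (Z \subset U); case: (#|Z| == p).
slia.
Qed.

Lemma card_swap (A : {set T}) i j : j \in A -> i \notin A -> #|i |: A :\ j| = #|A|.
Proof. by move=> jA iA; rewrite cardsU1 !inE (negbTE iA) andbF (cardsD1 j A) jA. Qed.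
End Counting.

Section Shifting.
Variable M : nat.
Implicit Types (A B : {set 'I_M}) (P Q F : {set {set 'I_M}}) (i j : 'I_M).

Definition wt A := \sum_(x in A) (x : nat).
Definition mu F := \sum_(A in F) wt A.

Lemma wt_swap A i j : j \in A -> i \notin A -> wt (i |: A :\ j) + j = wt A + i.
Proof.
move=> jA iA; rewrite /wt big_setU1 /=; last by rewrite !inE (negbTE iA) andbF.
by rewrite [in RHS](big_setD1 j) //=; slia.
Qed.

Definition sh i j F A : {set 'I_M} :=
  if [&& j \in A, i \notin A & i |: A :\ j \notin F] then i |: A :\ j else A.

Definition shift i j F := sh i j F @: F.

Lemma sh_inj i j F : {in F &, injective (sh i j F)}.
Proof.
move=> A B hA hB; rewrite /sh.
case: ifP => [/and3P[a1 a2 a3]|_]; case: ifP => [/and3P[b1 b2 b3]|_] // e.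
- apply/setP=> x; have := congr1 (fun X : {set 'I_M} => x \in X) e; rewrite /= !inE.
  case: (eqVneq x i) => [->|_] /=; first by rewrite (negbTE a2) (negbTE b2).
  by case: (eqVneq x j) => [->|_] //=; rewrite a1 b1.
- by rewrite e hB in a3.
- by rewrite -e hA in b3.
Qed.

Lemma card_shift i j F : #|shift i j F| = #|F|.
Proof. exact: (card_in_imset (@sh_inj i j F)). Qed.

Lemma card_sh i j F A : #|sh i j F A| = #|A|.
Proof. by rewrite /sh; case: ifP => // /and3P[a1 a2 _]; rewrite card_swap. Qed.

Lemma shift_unif i j F p : unif p F -> unif p (shift i j F).
Proof. by move=> h B /imsetP[A hA ->]; rewrite card_sh h. Qed.

Lemma shift_cross i j P Q : cross P Q -> cross (shift i j P) (shift i j Q).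
Proof.
have half : forall P Q A B, cross P Q -> A \in P -> B \in Q -> j \in A -> i \notin A ->
    sh i j Q B = B -> (i |: A :\ j) :&: B != set0.
  move=> {P Q} P Q A B c hA hB a1 a2; rewrite /sh => e.
  have [x /setIP[xA xB]] := set0Pn _ (c _ _ hA hB).
  case: (eqVneq x j) => [xj|xj]; last first.
    by apply/set0Pn; exists x; rewrite !inE xj xA xB orbT.
  case: (boolP (i \in B)) => iB; first by apply/set0Pn; exists i; rewrite !inE eqxx iB.
  rewrite xj in xB; move: e; rewrite xB iB /=; case: ifP => [_ e|/negbFE hB' _].
    by move: iB; rewrite -e !inE eqxx.
  have [y /setIP[yA]] := set0Pn _ (c _ _ hA hB'); rewrite !inE.
  case/orP=> [/eqP yi|/andP[yj yB]]; first by rewrite -yi yA in a2.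
  by apply/set0Pn; exists y; rewrite !inE yj yA yB orbT.
move=> c _ _ /imsetP[A hA ->] /imsetP[B hB ->].
have eA : sh i j P A = A \/ [/\ j \in A, i \notin A & sh i j P A = i |: A :\ j].
  by rewrite /sh; case: ifP => [/and3P[]|]; [right|left].
have eB : sh i j Q B = B \/ [/\ j \in B, i \notin B & sh i j Q B = i |: B :\ j].
  by rewrite /sh; case: ifP => [/and3P[]|]; [right|left].
case: eA => [eA|[a1 a2 eA]]; case: eB => [eB|[b1 b2 eB]].
- by rewrite eA eB c.
- by rewrite eA eB setIC; apply: (half Q P) => //; apply: crossC.
- by rewrite eA eB; apply: (half P Q).
- by rewrite eA eB; apply/set0Pn; exists i; rewrite !inE eqxx.
Qed.

Lemma wt_sh i j F A : i < j -> wt (sh i j F A) <= wt A.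
Proof.
move=> ij; rewrite /sh; case: ifP => // /and3P[a1 a2 _].
by have := wt_swap a1 a2; lia.
Qed.

Lemma mu_shift i j F : i < j -> mu (shift i j F) <= mu F.
Proof.
move=> ij; rewrite /mu big_imset /=; last exact: sh_inj.
by apply: leq_sum => A _; apply: wt_sh.
Qed.

Lemma stable_or_shift F : stable F \/ exists i j, i < j /\ mu (shift i j F) < mu F.
Proof.
case: (boolP [exists A in F, exists i : 'I_M, exists j : 'I_M,
    [&& i < j, j \in A, i \notin A & i |: A :\ j \notin F]]).
  move=> /existsP[A /andP[hA /existsP[i /existsP[j /and4P[ij jA iA h]]]]].
  right; exists i, j; split=> //; rewrite /mu big_imset /=; last exact: sh_inj.
  rewrite (bigD1 A) //= [X in _ < X](bigD1 A) //= -addSn; apply: leq_add; last first.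
    by apply: leq_sum => B _; apply: wt_sh.
  by rewrite /sh jA iA h /=; have := wt_swap jA iA; lia.
move=> h; left=> A i j hA ij jA iA; apply: contraR h => h.
apply/existsP; exists A; rewrite hA; apply/existsP; exists i; apply/existsP; exists j.
by rewrite ij jA iA.
Qed.

Lemma pair_shift p q P Q : cross P Q -> unif p P -> unif q Q ->
  exists P' Q', [/\ stable P' /\ stable Q', cross P' Q', unif p P' /\ unif q Q'
    & #|P'| = #|P| /\ #|Q'| = #|Q|].
Proof.
have [m] := ubnP (mu P + mu Q); elim: m => // m IH in P Q *; rewrite ltnS => hm c uP uQ.
have step i j : i < j -> mu (shift i j P) + mu (shift i j Q) < mu P + mu Q ->
    exists P' Q', [/\ stable P' /\ stable Q', cross P' Q', unif p P' /\ unif q Q'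
    & #|P'| = #|P| /\ #|Q'| = #|Q|].
  move=> ij h.
  have := IH (shift i j P) (shift i j Q) (leq_trans h hm) (shift_cross c)
    (shift_unif uP) (shift_unif uQ).
  by rewrite !card_shift.
case: (stable_or_shift P) => [sP|[i [j [ij h]]]]; last first.
  by apply: (step i j) => //; have := mu_shift Q ij; lia.
case: (stable_or_shift Q) => [sQ|[i [j [ij h]]]]; last first.
  by apply: (step i j) => //; have := mu_shift P ij; lia.
by exists P, Q.
Qed.

Lemma swap_ex q A : #|A| = q -> q <= M -> A != pre M q ->
  exists i j, [/\ i < q, q <= j, j \in A & i \notin A].
Proof.
move=> cA qM neq.
have [i /setDP[i1 i2]] : exists i, i \in pre M q :\: A.
  apply/set0Pn; apply: contra neq; rewrite setD_eq0 => s.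
  by rewrite eq_sym eqEcard s cA card_pre /=.
have [j /setDP[j1 j2]] : exists j, j \in A :\: pre M q.
  apply/set0Pn; apply: contra neq; rewrite setD_eq0 => s.
  by rewrite eqEcard s cA card_pre /=.
by exists i, j; split=> //; [rewrite inE in i1|rewrite inE -leqNgt in j2].
Qed.

Lemma stable_pre q Q : stable Q -> unif q Q -> q <= M -> Q != set0 -> pre M q \in Q.
Proof.
move=> sQ uQ qM /set0Pn[A0 hA0].
case: (arg_minnP wt hA0) => A hA Amin.
case: (eqVneq A (pre M q)) => [<- //|neq].
have [i [j [iq qj jA iA]]] := swap_ex (uQ _ hA) qM neq.
have := Amin _ (sQ _ i j hA (leq_trans iq qj) jA iA).
by have := wt_swap jA iA; slia.
Qed.

Lemma stable_pre2 q Q : stable Q -> unif q.+1 Q -> q.+1 < M -> 1 < #|Q| ->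
  pre M q.+2 :\: [set x : 'I_M | x == q :> nat] \in Q.
Proof.
move=> sQ uQ qM cQ.
have [A0 hA0] : exists A, A \in Q :\ pre M q.+1.
  apply/set0Pn; rewrite -card_gt0; move: cQ; rewrite (cardsD1 (pre M q.+1) Q).
  have := leq_b1 (pre M q.+1 \in Q); slia.
case: (arg_minnP wt hA0) => A hA0' Amin.
have {hA0'} /setD1P[neq hA] : A \in Q :\ pre M q.+1 := hA0'.
have low i j : i < j -> j \in A -> i \notin A -> i |: A :\ j = pre M q.+1.
  move=> ij jA iA; apply/eqP; apply: contraT => h.
  have h' : i |: A :\ j \in Q :\ pre M q.+1 by rewrite !inE h sQ.
  have := Amin _ h'; have := wt_swap jA iA; slia.
have [i [j [iq qj jA iA]]] := swap_ex (uQ _ hA) (ltnW qM) neq.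
have e := low _ _ (leq_trans iq qj) jA iA.
have memA x : (x \in A) = (x != i) && ((x < q.+1) || (x == j)).
  have := congr1 (fun X : {set 'I_M} => x \in X) e; rewrite /= !inE.
  case: (eqVneq x i) => [-> _|_] /=; first by rewrite (negbTE iA).
  by case: (eqVneq x j) => [->|_] /=; [rewrite jA orbT|rewrite orbF].
have qM' : q < M by slia.
have iq' : i = Ordinal qM'.
  apply/eqP; apply: contraT => h.
  have iq2 : i < q by move: h; rewrite -val_eqE /=; slia.
  have qA : Ordinal qM' \in A by rewrite memA eq_sym h /= ltnSn.
  have := low i (Ordinal qM') iq2 qA iA => e2.
  have : j \in i |: A :\ Ordinal qM'.
    by rewrite !inE jA andbT; apply/orP; right; rewrite -val_eqE /=; lia.
  by rewrite e2 inE ltnNge qj.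
have ej : j = q.+1 :> nat.
  apply/eqP; apply: contraT => h.
  have hA1 : Ordinal qM \notin A by rewrite memA -!val_eqE /=; lia.
  have jq : Ordinal qM < j by rewrite /=; slia.
  have e2 := low (Ordinal qM) j jq jA hA1.
  have : Ordinal qM \in pre M q.+1 by rewrite -e2 !inE eqxx.
  by rewrite inE /= ltnn.
suff -> : pre M q.+2 :\: [set x : 'I_M | x == q :> nat] = A by [].
by apply/setP=> x; rewrite !inE memA iq' -!val_eqE /= ej; lia.
Qed.
End Shifting.

(** * Bounds for cross-intersecting pairs *)

Section CrossBounds.
Variable M : nat.
Implicit Types (A B : {set 'I_M}) (P Q : {set {set 'I_M}}) (p q s : nat).

Lemma refl_dominated p A l : visits p A -> p + #|A| <= M -> l <= M ->
  cnt A l + cnt (refl p A) l <= l.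
Proof.
case=> l0 l0M hl0 hM lM; have [L [-> /andP[_ LM] eL maxL]] := reflP l0M hl0 hM.
case: (leqP l L) => hl; first by have := cnt_flip_le A hl LM; lia.
have := maxL l; rewrite hl lM => /(_ isT).
have := card_flip A LM; have := card_flip A lM; have := cnt_flip_ge A (ltnW hl) lM.
slia.
Qed.

Lemma refl_notin p P Q A : stable Q -> cross Q P -> A \in Q -> visits p A ->
  p + #|A| <= M -> refl p A \notin P.
Proof.
move=> sQ c hA vA hM; apply/negP=> hP.
have [l lM] := stable_dominated sQ c hA hP.
by rewrite ltnNge refl_dominated.
Qed.

(* The reflections of the members of [Q] outside [Q0] are new [p]-sets meeting [Q0]. *)
Lemma cross_bound p q P Q (Q0 : {set {set 'I_M}}) : stable Q -> cross Q P ->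
  unif p P -> unif q Q -> p + q <= M -> Q0 \subset Q ->
  (forall A, A \in Q :\: Q0 -> visits p A /\ forall X, X \in Q0 -> refl p A :&: X != set0) ->
  #|P| + #|Q| <= #|Q0| +
    #|[set Y : {set 'I_M} | (#|Y| == p) && [forall X in Q0, Y :&: X != set0]]|.
Proof.
move=> sQ c uP uQ hM sub hv.
have QD A : A \in Q :\: Q0 -> [/\ A \in Q, visits p A & #|A| = q].
  by move=> h; have [v _] := hv _ h; have /setDP[hA _] := h; rewrite (uQ _ hA).
rewrite -(cardsID Q0 Q) (setIidPr sub) addnCA leq_add2l.
rewrite -(card_in_imset (f := refl p) (D := Q :\: Q0)); last first.
  move=> A B /QD[_ vA cA] /QD[_ vB cB]; exact: (refl_inj vA vB cA cB hM).
have d : P :&: refl p @: (Q :\: Q0) = set0.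
  apply/setP=> Y; rewrite !inE; apply/negbTE/negP=> /andP[hY /imsetP[A hA e]].
  have [hAQ vA cA] := QD _ hA.
  by have := refl_notin sQ c hAQ vA; rewrite cA -e hY => /(_ hM).
rewrite -cardsUI d cards0 addn0; apply/subset_leq_card/subsetP=> Y; rewrite !inE.
case/orP=> [hY|/imsetP[A hA ->]].
  rewrite (uP _ hY) eqxx; apply/forallP=> X; apply/implyP=> hX.
  by rewrite setIC; apply: c => //; apply: (subsetP sub).
have [_ vA cA] := QD _ hA; rewrite card_refl ?cA // eqxx /=.
apply/forallP=> X; apply/implyP=> hX.
by have [_] := hv _ hA; apply.
Qed.

Definition svisits p A := exists2 l, l <= M & #|flip l A| < p.

Lemma svisitsW p A : svisits p A -> visits p A.
Proof. by case=> l lM h; exists l => //; apply: ltnW. Qed.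

Lemma refl_first p q A : svisits p A -> #|A| = q -> p + q <= M -> A != pre M q ->
  exists i : 'I_M, [/\ i < q, i \notin A, i \in refl p A & forall x : 'I_M, x < i -> x \in A].
Proof.
move=> [l lM hl] cA hM neq.
have [L [eL /andP[lL LM] cL _]] := reflP lM (ltnW hl) (etrans (congr1 (fun x => p + x <= M) cA) hM).
have qM : q <= M by lia.
have [i0 [_ [i0q _ _ i0A]]] := swap_ex cA qM neq.
case: (arg_minnP (P := fun i : 'I_M => i \notin A) (fun i : 'I_M => i : nat) i0A) => i iA imin.
exists i; split=> //.
- exact: leq_ltn_trans (imin _ i0A) i0q.
- rewrite eL inE (negbTE iA) /= ltnNge; apply/negP=> Li.
  have full m : m <= L -> cnt A m = m.
    move=> mL; rewrite -[RHS](@card_pre M m) ?(leq_trans mL) //.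
    apply: eq_card => x; rewrite !inE; case: (ltnP x m) => xm; rewrite ?andbF ?andbT //.
    apply: contraT => xA; have := imin _ xA.
    have := ltn_ord x; lia.
  have := card_flip A lM; have := card_flip A LM; rewrite !full //; lia.
- by move=> x xi; apply: contraT => xA; have := imin _ xA; rewrite leqNgt xi.
Qed.

Lemma cross_bound1 p q P Q : stable Q -> cross Q P -> unif p P -> unif q Q ->
  p + q <= M -> Q != set0 -> (forall A, A \in Q -> svisits p A) ->
  #|P| + #|Q| + 'C(M - q, p) <= 'C(M, p) + 1.
Proof.
move=> sQ c uP uQ hM Q0 hv.
have qM : q <= M by lia.
have hq := stable_pre sQ uQ qM Q0.
have sub : [set pre M q] \subset Q by rewrite sub1set.
have := cross_bound sQ c uP uQ hM sub; rewrite cards1.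
have -> : [set Y : {set 'I_M} | (#|Y| == p) && [forall X in [set pre M q], Y :&: X != set0]]
    = hits p setT (pre M q).
  apply/setP=> Y; rewrite !inE subsetT /=; congr (_ && _).
  by apply/forallP/idP=> [/(_ (pre M q))|h X]; rewrite inE ?eqxx //; apply/implyP=> /eqP->.
have := card_hits p (subsetT (pre M q)); rewrite cardsT card_ord card_pre // => e h.
suff : #|P| + #|Q| <= 1 + #|hits p [set: 'I_M] (pre M q)| by slia.
apply: h => A /setDP[hA]; rewrite inE => neq; split; first exact/svisitsW/hv.
move=> X; rewrite inE => /eqP->.
have [i [iq _ ir _]] := refl_first (hv _ hA) (uQ _ hA) hM neq.
by apply/set0Pn; exists i; rewrite in_setI ir inE; lia.
Qed.

Lemma cross_bound2 q P Q : stable Q -> cross Q P -> unif q P -> unif q.+1 Q ->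
  q + q.+1 <= M -> 3 <= q -> 1 < #|Q| -> (forall A, A \in Q -> svisits q A) ->
  #|P| + #|Q| + 2 * 'C(M - q.+1, q) <= 'C(M, q) + 'C(M - q.+2, q) + 2.
Proof.
move=> sQ c uP uQ hM q3 cQ hv.
have qM : q.+1 <= M by lia.
have qM2 : q.+2 <= M by lia.
have Q0 : Q != set0 by rewrite -card_gt0; slia.
have hq := stable_pre sQ uQ qM Q0.
have := stable_pre2 sQ uQ qM2 cQ; set q1 := _ :\: _ => hq1.
have cq1 : #|q1| = q.+1 by exact: uQ.
have neq : pre M q.+1 != q1.
  apply/eqP=> /setP/(_ (Ordinal qM2)); rewrite !inE /= ltnn ltnS leqnn andbT.
  by rewrite gtn_eqF.
have eU : pre M q.+1 :|: q1 = pre M q.+2.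
  by apply/setP=> x; rewrite !inE; lia.
have sub : [set pre M q.+1; q1] \subset Q by rewrite subUset !sub1set hq hq1.
have := cross_bound sQ c uP uQ hM sub; rewrite cards2 neq.
have := card_hits2 q (subsetT (pre M q.+1)) (subsetT q1).
set S := [set Z : {set 'I_M} | _]; set S' := [set Y : {set 'I_M} | _].
have -> : S' = S.
  apply/setP=> Y; rewrite !inE subsetT /=; congr (_ && _).
  apply/forallP/andP=> [h|[h1 h2] X].
    by have := h (pre M q.+1); have := h q1; rewrite !inE !eqxx orbT /= => -> ->.
  by rewrite !inE; apply/implyP=> /orP[/eqP->|/eqP->].
rewrite eU cardsT card_ord cq1 !card_pre // => e h.
suff : #|P| + #|Q| <= 2 + #|S| by slia.
apply: h => A /setDP[hA]; rewrite !inE negb_or => /andP[n1 n2].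
split; first exact/svisitsW/hv.
have [i [iq iA ir imin]] := refl_first (hv _ hA) (uQ _ hA) hM n1.
move=> X; rewrite !inE => /orP[] /eqP->.
  by apply/set0Pn; exists i; rewrite in_setI ir inE; lia.
case: (eqVneq (i : nat) q) => iq'; last first.
  by apply/set0Pn; exists i; rewrite in_setI ir !inE iq'; lia.
apply/set0Pn; exists (Ordinal qM2); rewrite in_setI; apply/andP; split; last first.
  by rewrite !inE /= ltnS leqnn gtn_eqF.
have zA : Ordinal qM2 \notin A.
  apply: contra n2 => zA; rewrite eq_sym eqEcard cq1 (uQ _ hA) leqnn andbT.
  apply/subsetP=> x; rewrite !inE => /andP[xq xq2].
  case: (ltnP x q) => hx; first by apply: imin; rewrite iq'.
  by have -> : x = Ordinal qM2 by apply: val_inj => /=; lia.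
have vis : #|flip q.+2 A| <= q.
  have : q <= cnt A q.+2.
    rewrite -[X in X <= _](@card_pre M q); last lia.
    apply/subset_leq_card/subsetP=> x; rewrite !inE => xq.
    by rewrite imin ?iq' //=; lia.
  have := card_flip A qM2; rewrite (uQ _ hA); lia.
have hM' : q + #|A| <= M by rewrite (uQ _ hA).
have [L [-> /andP[qL _] _ _]] := reflP qM2 vis hM'.
by rewrite inE (negbTE zA) /=.
Qed.

(* A member of [Q] violating [visits s] has small prefix counts, so by domination every
   member of [P] has a large one. *)
Lemma visits_dichotomy p q s t P Q : stable Q -> cross Q P -> unif p P -> unif q Q ->
  p + q <= s + t + 3 ->
  (forall A, A \in Q -> visits s A) \/ (forall B, B \in P -> visits t B).
Proof.
move=> sQ c uP uQ hst.
case: (boolP [forall A in Q, exists l : 'I_M.+1, #|flip l A| <= s]).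
  move=> /forallP h; left=> A hA; have := h A; rewrite hA => /existsP[l hl].
  by exists l => //; rewrite -ltnS.
rewrite negb_forall => /existsP[A]; rewrite negb_imply => /andP[hA].
rewrite negb_exists => /forallP hl; right=> B hB.
have [l lM hcnt] := stable_dominated sQ c hA hB.
have {}hl : s < #|flip l A| by rewrite ltnNge; exact: (hl (Ordinal (lM : l < M.+1))).
exists l => //.
have := card_flip A lM; have := card_flip B lM; rewrite (uQ _ hA) (uP _ hB); lia.
Qed.

Lemma cross_HM p q P Q : cross P Q -> unif p P -> unif q Q -> q <= p -> p + q <= M ->
  Q != set0 -> (p = q -> P != set0) -> #|P| + #|Q| + 'C(M - q, p) <= 'C(M, p) + 1.
Proof.
move=> c uP uQ qp hM Q0 P0.
have [P' [Q' [[sP sQ] c' [uP' uQ'] [eP eQ]]]] := pair_shift c uP uQ.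
rewrite -!card_gt0 -eP -eQ !card_gt0 in Q0 P0 *.
have c2 := crossC c'.
move: qp; rewrite leq_eqVlt => /orP[/eqP e|qp]; last first.
  apply: (cross_bound1 sQ c2 uP' uQ' hM Q0) => A hA; exists 0 => //.
  have := card_flip A (leq0n M); rewrite cnt0 (uQ' _ hA); lia.
have {}P0 := P0 (esym e); rewrite e in uQ' hM *.
clear e uP uQ c; case: p => [|p] in uP' uQ' hM *.
  have [A hA] := set0Pn _ P0; have [B hB] := set0Pn _ Q0.
  have := c' _ _ hA hB; have := uP' _ hA => /eqP; rewrite cards_eq0 => /eqP->.
  by rewrite set0I eqxx.
have h3 : p.+1 + p.+1 <= p + p + 3 by lia.
have [h|h] := visits_dichotomy sQ c2 uP' uQ' h3.
- by apply: (cross_bound1 sQ c2 uP' uQ' hM Q0) => A /h [l lM hl]; exists l.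
- rewrite (addnC #|P'|).
  by apply: (cross_bound1 sP c' uQ' uP' hM P0) => A /h [l lM hl]; exists l.
Qed.

Lemma cross_small p q s P Q : cross P Q -> unif p P -> unif q Q -> p + q <= 2 * s + 3 ->
  s + p <= M -> s + q <= M -> #|P| <= 'C(M, s) \/ #|Q| <= 'C(M, s).
Proof.
move=> c uP uQ hst hp hq.
have [P' [Q' [[sP sQ] c' [uP' uQ'] [<- <-]]]] := pair_shift c uP uQ.
have h3 : p + q <= s + s + 3 by lia.
have [h|h] := visits_dichotomy sQ (crossC c') uP' uQ' h3.
- by right; apply: (visits_card uQ' h).
- by left; apply: (visits_card uP' h).
Qed.

Lemma cross_good_or_small q P Q : cross P Q -> unif q P -> unif q.+1 Q ->
  q + q.+1 <= M -> 3 <= q -> Q != set0 ->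
  (#|P| + #|Q| + 'C(M - q.+1, q) <= 'C(M, q) + 1 /\
   (1 < #|Q| -> #|P| + #|Q| + 2 * 'C(M - q.+1, q) <= 'C(M, q) + 'C(M - q.+2, q) + 2))
  \/ #|P| <= 'C(M, q.-1).
Proof.
move=> c uP uQ hM q3 Q0.
have [P' [Q' [[sP sQ] c' [uP' uQ'] [eP eQ]]]] := pair_shift c uP uQ.
rewrite -card_gt0 -eP -eQ card_gt0 in Q0 *.
have c2 := crossC c'.
have h3 : q + q.+1 <= q.-1 + q.-1 + 3 by lia.
have [h|h] := visits_dichotomy sQ c2 uP' uQ' h3; last first.
  by right; apply: (visits_card uP' h); lia.
have hs A : A \in Q' -> svisits q A by move=> /h[l lM hl]; exists l => //; lia.
left; split; first exact: cross_bound1.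
by move=> cQ; apply: cross_bound2.
Qed.
End CrossBounds.

Section Transport.
Variables (S T : finType) (g : S -> T).
Hypothesis g_inj : injective g.

Lemma card_preim_inj (A : {set T}) : #|g @^-1: A| = #|A :&: g @: setT|.
Proof.
rewrite -(card_imset _ g_inj); apply: eq_card => x; rewrite !inE.
apply/imsetP/andP=> [[y]|[xA /imsetP[y _ e]]].
  by rewrite inE => yA ->; rewrite yA imset_f.
by exists y => //; rewrite inE -e.
Qed.

Lemma preim_neq0 (A : {set T}) x : x \in A -> x \in g @: setT -> g @^-1: A != set0.
Proof.
move=> xA xg; rewrite -card_gt0 card_preim_inj card_gt0.
by apply/set0Pn; exists x; rewrite inE xA.
Qed.
End Transport.

Lemma cross_HM_on (T : finType) (U : {set T}) p q (P Q : {set {set T}}) :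
  (forall A, A \in P -> A \subset U) -> (forall A, A \in Q -> A \subset U) ->
  cross P Q -> unif p P -> unif q Q -> q <= p -> p + q <= #|U| ->
  Q != set0 -> (p = q -> P != set0) ->
  #|P| + #|Q| + 'C(#|U| - q, p) <= 'C(#|U|, p) + 1.
Proof.
move=> sP sQ c uP uQ qp hU Q0 P0.
pose g : 'I_#|U| -> T := enum_val.
have g_inj : injective g := enum_val_inj.
have gT : g @: setT = U.
  apply/setP=> x; apply/imsetP/idP=> [[i _ ->]|xU]; first exact: enum_valP.
  by exists (enum_rank_in xU x) => //; rewrite /g enum_rankK_in.
pose tr (R : {set {set T}}) := [set g @^-1: (A : {set T}) | A in R].
have ctr (R : {set {set T}}) : (forall A, A \in R -> A \subset U) -> #|tr R| = #|R|.
  move=> sR; apply: card_in_imset => A B hA hB e; apply/setP=> x.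
  case: (boolP (x \in U)) => xU; last first.
    by rewrite (contraNF (subsetP (sR _ hA) x)) ?(contraNF (subsetP (sR _ hB) x)).
  move: xU; rewrite -gT => /imsetP[i _ ->].
  by have := congr1 (fun X : {set 'I_#|U|} => i \in X) e; rewrite /= !inE.
have utr (R : {set {set T}}) r : (forall A, A \in R -> A \subset U) -> unif r R -> unif r (tr R).
  move=> sR uR X /imsetP[A hA ->]; rewrite card_preim_inj // gT.
  by rewrite (setIidPl (sR _ hA)) uR.
have ntr (R : {set {set T}}) : R != set0 -> tr R != set0.
  by case/set0Pn=> A hA; apply/set0Pn; exists (g @^-1: A); apply: imset_f.
have ctr' : cross (tr P) (tr Q).
  move=> _ _ /imsetP[A hA ->] /imsetP[B hB ->]; rewrite -preimsetI.
  have [x hx] := set0Pn _ (c _ _ hA hB); apply: (preim_neq0 g_inj hx).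
  by rewrite gT; move: hx; rewrite inE => /andP[xA _]; apply: (subsetP (sP _ hA)).
have := cross_HM ctr' (utr _ _ sP uP) (utr _ _ sQ uQ) qp hU (ntr _ Q0) (fun e => ntr _ (P0 e)).
by rewrite !ctr.
Qed.

(** * Counting by the first element met *)

Lemma bin_supermodular N i j K : 'C(N + i, K) + 'C(N + j, K) <= 'C(N, K) + 'C(N + i + j, K).
Proof.
case: K => [|K]; first by rewrite !bin0.
elim: i => [|i IH]; first by rewrite !addn0.
rewrite addnS addSn !binS.
have : 'C(N + i, K) <= 'C(N + i + j, K) by rewrite leq_bin2l // leq_addr.
lia.
Qed.

Section Ordering.
Variable T : finType.
Implicit Types (U S X Y Z : {set T}) (A D : {set {set T}}) (m r c : nat).

Definition star (x : T) (A : {set {set T}}) := [set X in A | x \in X].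

Definition del (x : T) (A : {set {set T}}) := [set X :\ x | X in A & x \in X].

Lemma card_del x A : #|del x A| = #|star x A|.
Proof.
apply: card_in_imset => X Y; rewrite !inE => /andP[_ xX] /andP[_ xY] e.
by rewrite -(setD1K xX) e setD1K.
Qed.

Lemma card_split x A : #|A| = #|star x A| + #|[set X in A | x \notin X]|.
Proof.
rewrite -(cardsID [set X : {set T} | x \in X] A); congr (_ + _); apply: eq_card => X; rewrite !inE //.
by rewrite andbC.
Qed.

Lemma del_unif m x A : unif m.+1 A -> unif m (del x A).
Proof.
move=> uA Y /imsetP[X]; rewrite inE => /andP[hX xX] ->.
by have := uA _ hX; rewrite (cardsD1 x) xX => -[].
Qed.

Lemma del_cross x A (P : {set {set T}}) : cross A P -> (forall X, X \in P -> x \notin X) -> cross (del x A) P.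
Proof.
move=> cA xP Y B /imsetP[X]; rewrite inE => /andP[hX xX] -> hB.
have [y /setIP[yX yB]] := set0Pn _ (cA _ _ hX hB).
apply/set0Pn; exists y; rewrite !inE yX yB !andbT.
by apply: contraNneq (xP _ hB) => <-.
Qed.

Lemma star_hit m c x U A Z : (forall X, X \in A -> X \subset U) -> unif m.+1 A -> x \in U ->
  x \notin Z -> #|Z| <= c -> (forall X, X \in A -> X :&: Z != set0) ->
  #|star x A| + 'C(#|U|.-1 - c, m) <= 'C(#|U|.-1, m).
Proof.
move=> sA uA xU xZ cZ hZ; rewrite -card_del.
have := card_hits m (subsetIl (U :\ x) Z).
have cU : #|U :\ x| = #|U|.-1 by rewrite (cardsD1 x U) xU.
rewrite cU => <-; apply: leq_add; last first.
  rewrite leq_bin2l // leq_sub2l // (leq_trans _ cZ) //.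
  exact/subset_leq_card/subsetIr.
apply/subset_leq_card/subsetP=> Y hY; have cY := del_unif uA hY.
move: hY => /imsetP[X]; rewrite inE => /andP[hX xX] e.
rewrite inE cY eqxx /= e setSD ?sA //=.
have [y /setIP[yX yZ]] := set0Pn _ (hZ _ hX).
apply/set0Pn; exists y; rewrite !inE yX yZ (subsetP (sA _ hX)) // !andbT !andbb.
by apply: contraNneq xZ => <-.
Qed.

Lemma first_hit m U S A : (forall X, X \in A -> X \subset U) -> unif m.+1 A ->
  S \subset U -> m.+1 + #|S| <= #|U| ->
  (forall x, x \in S -> exists Z, [/\ x \notin Z, #|Z| <= m.+1
     & forall X, X \in A -> X :&: Z != set0]) ->
  #|[set X in A | X :&: S != set0]| + 'C(#|U| - #|S|, m.+1) + 'C(#|U| - m.+1, m.+1)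
    <= 'C(#|U|, m.+1) + 'C(#|U| - m.+1 - #|S|, m.+1).
Proof.
move: {2}#|S| (leqnn #|S|) => k; elim: k => [|k IH] in U S A *.
  rewrite leqn0 cards_eq0 => /eqP-> _ _ _ _ _; rewrite cards0 !subn0.
  rewrite (_ : [set X in A | _] = set0) ?cards0 ?add0n //.
  by apply/setP=> X; rewrite !inE setI0 eqxx andbF.
move=> kS sA uA SU hU hZ; case: (set_0Vmem S) => [S0|[x xS]].
  by apply: IH => //; rewrite S0 cards0.
have cS : #|S| = #|S :\ x|.+1 by rewrite (cardsD1 x) xS.
have xU := subsetP SU _ xS.
have cU : #|U| = #|U :\ x|.+1 by rewrite (cardsD1 x) xU.
have [Z [xZ cZ AZ]] := hZ _ xS.
have := star_hit sA uA xU xZ cZ AZ.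
pose A' := [set X in A | x \notin X].
have := IH (U :\ x) (S :\ x) A'.
have sA' : forall X, X \in A' -> X \subset U :\ x.
  by move=> X; rewrite inE => /andP[hX xX]; rewrite subsetD1 sA.
have uA' : unif m.+1 A' by move=> X; rewrite inE => /andP[/uA].
rewrite cS cU /= in kS hU *.
move=> /(_ kS sA' uA' (setSD _ SU)); rewrite addnS ltnS in hU => /(_ hU) IH'.
have hZ' y : y \in S :\ x -> exists Z, [/\ y \notin Z, #|Z| <= m.+1
     & forall X, X \in A' -> X :&: Z != set0].
  rewrite !inE => /andP[_ yS]; have [Z' [h1 h2 h3]] := hZ _ yS.
  by exists Z'; split=> // X; rewrite inE => /andP[/h3].
have {IH'} := IH' hZ'.
have : #|[set X in A | X :&: S != set0]| <=
    #|star x A| + #|[set X in A' | X :&: (S :\ x) != set0]|.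
  apply: leq_trans _ (leq_of_leqif (leq_card_setU _ _)); apply/subset_leq_card/subsetP=> X.
  rewrite !inE => /andP[-> h]; case: (boolP (x \in X)) => //= xX.
  have [y /setIP[yX yS]] := set0Pn _ h; apply/set0Pn; exists y; rewrite !inE yX yS.
  by rewrite andbT; apply: contraNneq xX => <-.
move: #|star x A| #|[set X in A | X :&: S != set0]|
  #|[set X in A' | X :&: (S :\ x) != set0]| #|U :\ x| #|S :\ x| hU => a b c u s hU.
rewrite !subSS.
have e1 : 'C(u.+1, m.+1) = 'C(u, m.+1) + 'C(u, m) by rewrite binS.
have e2 : 'C(u - m, m.+1) = 'C(u - m.+1, m.+1) + 'C(u - m.+1, m).
  by rewrite -binS subnSK //; lia.
have -> : u - m - s.+1 = u - m.+1 - s by lia.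
lia.
Qed.

(* Induction along the elements [x] of [d]: the sets of [A] through [x] are traded
   against the sets of [D] avoiding [x], and conversely. *)
Lemma star_trade m r U A D d : (forall X, X \in A -> X \subset U) ->
  (forall X, X \in D -> X \subset U) -> cross A D -> unif m.+1 A -> unif r D ->
  d \in D -> r <= m -> 0 < m -> m.+1 + m.+1 + r < #|U| ->
  (forall x, x \in d -> exists Z, [/\ x \notin Z, #|Z| <= m.+1
     & forall X, X \in A -> X :&: Z != set0]) ->
  (r = m -> A != set0) ->
  #|A| + #|D| + 'C(#|U| - r, m.+1) + 'C(#|U| - m.+1, m.+1)
    <= 'C(#|U|, m.+1) + 'C(#|U| - m.+1 - r, m.+1) + 1.
Proof.
elim: r U A D d => [|r IH] U A D d sA sD c uA uD hd rm m0 hU hZ hA.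
  have d0 : d = set0 by apply/eqP; rewrite -cards_eq0 (uD _ hd).
  have -> : A = set0.
    apply/eqP/set0Pn=> -[X hX]; have := c _ _ hX hd.
    by rewrite d0 setI0 eqxx.
  have -> : D = [set set0].
    apply/setP=> X; rewrite inE; apply/idP/eqP=> [hX|->]; last by rewrite -d0.
    by apply/eqP; rewrite -cards_eq0 (uD _ hX).
  by rewrite cards0 cards1 !subn0; lia.
have [x [xd xA]] : exists x, x \in d /\ (r.+1 = m -> exists2 X, X \in A & x \in X).
  case: (set_0Vmem A) => [A0|[X hX]].
    have /set0Pn[x xd] : d != set0 by rewrite -card_gt0 (uD _ hd).
    by exists x; split=> // e; move: (hA e); rewrite A0 eqxx.
  have [x /setIP[xX xd]] := set0Pn _ (c _ _ hX hd).
  by exists x; split=> // _; exists X.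
have xU := subsetP (sD _ hd) _ xd.
have cU : #|U| = #|U :\ x|.+1 by rewrite (cardsD1 x) xU.
pose A0 := [set X in A | x \notin X]; pose D0 := [set X in D | x \notin X].
have sA0 : forall X, X \in A0 -> X \subset U :\ x.
  by move=> X; rewrite inE => /andP[hX xX]; rewrite subsetD1 sA.
have sD0 : forall X, X \in D0 -> X \subset U :\ x.
  by move=> X; rewrite inE => /andP[hX xX]; rewrite subsetD1 sD.
have sdel (P : {set {set T}}) : (forall X, X \in P -> X \subset U) ->
    forall X, X \in del x P -> X \subset U :\ x.
  by move=> sP Y /imsetP[X]; rewrite inE => /andP[hX _] ->; rewrite setSD ?sP.
have uA0 : unif m.+1 A0 by move=> X; rewrite inE => /andP[/uA].
have uD0 : unif r.+1 D0 by move=> X; rewrite inE => /andP[/uD].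
have c10 : cross (del x A) D0.
  apply: del_cross => [X Y hX|X]; rewrite inE => /andP[hY xY] //; exact: c.
have c01 : cross A0 (del x D).
  apply/crossC/del_cross => [X Y hX|X]; rewrite inE => /andP[hY xY] //.
  by rewrite setIC; apply: c.
have hd' : d :\ x \in del x D by apply: imset_f; rewrite inE hd.
have hZ' y : y \in d :\ x -> exists Z, [/\ y \notin Z, #|Z| <= m.+1
     & forall X, X \in A0 -> X :&: Z != set0].
  rewrite !inE => /andP[_ /hZ [Z [h1 h2 h3]]]; exists Z; split=> // X.
  by rewrite inE => /andP[/h3].
have hU' : m.+1 + m.+1 + r < #|U :\ x| by move: hU; rewrite cU; lia.
have := IH (U :\ x) A0 (del x D) (d :\ x) sA0 (sdel _ sD) c01 uA0 (del_unif uD) hd'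
  (ltnW rm) m0 hU' hZ'.
have rm' : r = m -> A0 != set0 by lia.
move=> /(_ rm').
have : #|del x A| + #|D0| + 'C(#|U :\ x| - m.+1, m) <= 'C(#|U :\ x|, m).
  have [Z [xZ cZ AZ]] := hZ _ xd.
  case: (eqVneq D0 set0) => [->|D0n].
    by rewrite cards0 addn0 card_del; have := star_hit sA uA xU xZ cZ AZ; rewrite cU.
  have hU2 : m + r.+1 <= #|U :\ x| by move: hU'; lia.
  have h1 : m = r.+1 -> del x A != set0.
    move=> e; have [X hX xX] := xA (esym e).
    by apply/set0Pn; exists (X :\ x); apply: imset_f; rewrite inE hX.
  have := cross_HM_on (sdel _ sA) sD0 c10 (del_unif uA) uD0 rm hU2 D0n h1.
  move: #|del x A| #|D0| #|U :\ x| hU' => a b u hU'.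
  have : 'C(u - m.+1, m) + 1 <= 'C(u - r.+1, m).
    apply: leq_trans (_ : _ <= 'C((u - m.+1).+1, m)) _; last by rewrite leq_bin2l //; lia.
    case: m m0 {IH hZ hA hZ' uA uA0 cZ rm' xA h1 hU2 rm hU} hU' => // m _ hU'.
    by rewrite binS leq_add2l bin_gt0; lia.
  lia.
rewrite (card_split x A) (card_split x D) -!card_del -/A0 -/D0 cU.
move: #|del x A| #|A0| #|del x D| #|D0| #|U :\ x| hU' => a1 a0 d1 d0 u hU'.
rewrite !subSS.
have e1 : 'C(u.+1, m.+1) = 'C(u, m.+1) + 'C(u, m) by rewrite binS.
have e2 : 'C(u - m, m.+1) = 'C(u - m.+1, m.+1) + 'C(u - m.+1, m).
  by rewrite -binS subnSK //; lia.
have -> : u - m - r.+1 = u - m.+1 - r by lia.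
lia.
Qed.

Lemma star_bound m U A Y Y' : (forall X, X \in A -> X \subset U) -> unif m.+1 A ->
  Y \subset U -> Y' \subset U -> #|Y| = m.+1 -> #|Y'| = m.+1 -> Y != Y' -> Y :&: Y' != set0 ->
  m.+1 + m.+1 <= #|U| ->
  (forall X, X \in A -> X :&: Y != set0) -> (forall X, X \in A -> X :&: Y' != set0) ->
  (forall x, exists Z, [/\ x \notin Z, #|Z| <= m.+1
     & forall X, X \in A -> X :&: Z != set0]) ->
  #|A| + 3 * 'C(#|U| - m.+1, m.+1)
    <= 'C(#|U|, m.+1) + 'C(#|U| - m.+2, m.+1) + 'C(#|U| - (m + m.+1), m.+1).
Proof.
move=> sA uA YU Y'U cY cY' neq int hU AY AY' hZ.
pose S := Y :&: Y'; have SU : S \subset U by apply: subset_trans (subsetIl _ _) YU.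
have s0 : 0 < #|S| by rewrite card_gt0.
have sm : #|S| <= m.
  rewrite leqNgt; apply: contra neq => h.
  have e1 : S = Y by apply/eqP; rewrite eqEcard subsetIl cY.
  have e2 : S = Y' by apply/eqP; rewrite eqEcard subsetIr cY'.
  by rewrite -{1}e1 e2.
have hUS : m.+1 + #|S| <= #|U| by lia.
have := first_hit sA uA SU hUS (fun x _ => hZ x).
have YS : Y :\: S \subset U :\: S by apply: setSD.
have Y'S : Y' :\: S \subset U :\: S by apply: setSD.
have := card_hits2 m.+1 YS Y'S; set H := [set Z : {set T} | _].
have cYS : #|Y :\: S| = m.+1 - #|S| by rewrite cardsDS ?subsetIl // cY.
have cY'S : #|Y' :\: S| = m.+1 - #|S| by rewrite cardsDS ?subsetIr // cY'.
have -> : #|Y :\: S :|: Y' :\: S| = 2 * (m.+1 - #|S|).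
  rewrite cardsU cYS cY'S (_ : _ :&: _ = set0) ?cards0; first lia.
  by apply/setP=> x; rewrite !inE; case: (x \in Y); case: (x \in Y').
rewrite cYS cY'S cardsDS //.
have : #|A| <= #|[set X in A | X :&: S != set0]| + #|H|.
  apply: leq_trans _ (leq_of_leqif (leq_card_setU _ _)); apply/subset_leq_card/subsetP=> X hX.
  rewrite in_setU; apply/orP; case: (eqVneq (X :&: S) set0) => e; last first.
    by left; rewrite inE hX e.
  right.
  have xS x : x \in X -> x \in S = false.
    by move=> xX; apply/negP=> xS; have : x \in X :&: S; [rewrite inE xX|rewrite e inE].
  rewrite inE subsetD sA // -setI_eq0 e eqxx (uA _ hX) eqxx /=; apply/andP; split.
    have [y /setIP[yX yY]] := set0Pn _ (AY _ hX).
    by apply/set0Pn; exists y; rewrite in_setI in_setD xS // yX.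
  have [y /setIP[yX yY]] := set0Pn _ (AY' _ hX).
  by apply/set0Pn; exists y; rewrite in_setI in_setD xS // yX.
move: #|[set X in A | X :&: S != set0]| #|H| #|A| #|S| #|U| s0 sm hU => a h b s u s0 sm hU.
have -> : u - s - (m.+1 - s) = u - m.+1 by lia.
have -> : u - s - 2 * (m.+1 - s) = u - (m + m.+1) + s.-1 by lia.
have -> : u - m.+1 - s = u - (m + m.+1) + (m - s) by lia.
have := bin_supermodular (u - (m + m.+1)) s.-1 (m - s) m.+1.
have -> : u - (m + m.+1) + s.-1 + (m - s) = u - m.+2 by lia.
lia.
Qed.
End Ordering.

(** * Six families *)

Lemma bin_pred n k : 0 < n -> 0 < k -> 'C(n, k) = 'C(n.-1, k) + 'C(n.-1, k.-1).
Proof. by case: n k => // n [|k] // _ _; rewrite binS. Qed.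

Lemma bin_pred_ge q v : 16 * q <= v -> 15 * 'C(v, q) <= 16 * 'C(v.-1, q).
Proof.
case: q => [|q]; first by rewrite !bin0.
case: v => [|v] hv; first by lia.
have e := mul_bin_diag v.+1 q; rewrite /= in e.
rewrite binS /=; suff : 16 * 'C(v, q) <= 'C(v.+1, q.+1) by rewrite binS; lia.
rewrite -(leq_pmul2l (ltn0Sn v)) mulnCA e mulnA.
by rewrite leq_mul2r hv orbT.
Qed.

Lemma bin_telescope N K m : K <= N ->
  'C(N, m.+1) = 'C(N - K, m.+1) + \sum_(j < K) 'C(N - j.+1, m).
Proof.
elim: K => [|K IH] hK; first by rewrite subn0 big_ord0 addn0.
have e : 'C(N - K, m.+1) = 'C(N - K.+1, m.+1) + 'C(N - K.+1, m) by rewrite -binS subnSK.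
by rewrite big_ord_recr /= IH ?(ltnW hK) // e -addnA; congr (_ + _); apply: addnC.
Qed.

Lemma geometric_ge (x : nat -> nat) : (forall r, r < 8 -> 15 * x r <= 16 * x r.+1) ->
  5 * x 0 <= \sum_(r < 8) x r.+1.
Proof.
move=> h; rewrite !big_ord_recr big_ord0 /=.
have := h 0 isT; have := h 1 isT; have := h 2 isT; have := h 3 isT.
have := h 4 isT; have := h 5 isT; have := h 6 isT; have := h 7 isT.
lia.
Qed.

Lemma sum_ord_ge a b (x : nat -> nat) : a <= b -> \sum_(r < a) x r <= \sum_(r < b) x r.
Proof.
move=> /subnK <-; elim: (b - a) => // d IH.
by rewrite addSn big_ord_recr /=; apply: leq_trans IH (leq_addr _ _).
Qed.

Section Numerics.
Variables m M : nat.
Hypotheses (m_ge : 11 <= m) (M_ge : 18 * m + 33 <= M).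

Lemma gamma_small :
  5 * 'C(M, m.-1) + 2 * 'C(M - m.+1, m) <= 'C(M, m) + 'C(M - m.+2, m).
Proof.
case: m m_ge M_ge => // q hq hM; rewrite [_.-1]/=.
have e0 : 'C(M, q.+1) = 'C(M - q.+2, q.+1) + \sum_(j < q.+2) 'C(M - j.+1, q).
  by apply: bin_telescope; lia.
have e1 : 'C(M - q.+2, q.+1) = 'C(M - q.+3, q.+1) + 'C(M - q.+3, q).
  by rewrite -binS subnSK //; lia.
have h5 : 5 * 'C(M - 0, q) <= \sum_(r < 8) 'C(M - r.+1, q).
  apply: (geometric_ge (x := fun r => 'C(M - r, q))) => r r8; rewrite subnS.
  by apply: bin_pred_ge; lia.
have h8 : \sum_(r < 8) 'C(M - r.+1, q) <= \sum_(r < q.+1) 'C(M - r.+1, q).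
  by apply: (sum_ord_ge (fun r => 'C(M - r.+1, q))); lia.
have hl : 'C(M - q.+3, q) <= 'C(M - q.+2, q) by rewrite leq_bin2l //; lia.
rewrite big_ord_recr /= in e0; rewrite subn0 in h5.
move: h5 h8 e0; move: (\sum_(j < 8) _) (\sum_(j < q.+1) _) => s1 s2 h5 h8 e0.
lia.
Qed.

Lemma hit_large : 5 * 'C(M, m) + 'C(M - m, m.+1) + 'C(M - m.+1, m.+1)
  <= 'C(M, m.+1) + 'C(M - (m + m.+1), m.+1) + 5 * 'C(M - m.+1, m).
Proof.
pose x r := \sum_(j < m.+1) 'C(M - r - j.+1, m.-1).
have ex r : r <= m -> 'C(M - r, m) = 'C(M - (r + m.+1), m) + x r.
  move=> rm; rewrite subnDA /x; case: m m_ge M_ge rm => // q _ hM rm.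
  by apply: bin_telescope; lia.
have e1 : 'C(M, m.+1) = 'C(M - m, m.+1) + \sum_(r < m) 'C(M - r.+1, m).
  by apply: bin_telescope; lia.
have e2 : 'C(M - m.+1, m.+1) =
    'C(M - m.+1 - m, m.+1) + \sum_(r < m) 'C(M - m.+1 - r.+1, m).
  by apply: bin_telescope; lia.
have e3 : \sum_(r < m) 'C(M - r.+1, m) =
    \sum_(r < m) 'C(M - m.+1 - r.+1, m) + \sum_(r < m) x r.+1.
  rewrite -big_split /=; apply: eq_bigr => r _.
  by rewrite -subnDA (addnC m.+1); apply/ex/ltn_ord.
have h5 : 5 * x 0 <= \sum_(r < 8) x r.+1.
  apply: geometric_ge => r r8; rewrite /x !big_distrr /=; apply: leq_sum => j _.
  have -> : M - r.+1 - j.+1 = (M - r - j.+1).-1 by lia.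
  by apply: bin_pred_ge; have := ltn_ord j; lia.
have h8 : \sum_(r < 8) x r.+1 <= \sum_(r < m) x r.+1.
  by apply: (sum_ord_ge (fun r => x r.+1)); lia.
have := ex 0 isT; rewrite subn0 add0n.
have -> : M - (m + m.+1) = M - m.+1 - m by lia.
move: e1 e2 e3 h5 h8; move: (\sum_(_ < 8) _) (\sum_(_ < m) x _) (\sum_(_ < m) _)
  (\sum_(_ < m) _) => s1 s2 s3 s4.
lia.
Qed.
End Numerics.

Section SixFamilies.
Variables M m : nat.
Implicit Types (A B C D E G P Q : {set {set 'I_M}}) (i j x : 'I_M).

Definition no_common P := forall x, exists2 Y, Y \in P & x \notin Y.

(* For an intersecting family with 3-cover [{a, b, c}], these are the links of the
   traces [{a}], [{b}], [{c}] and [{b, c}], [{a, c}], [{a, b}]; the [no_common]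
   conditions say that no pair containing [a] (resp. [b], [c]) is a cover. *)
Definition sys A B C D E G : Prop :=
  [/\ [/\ unif m.+1 A, unif m.+1 B & unif m.+1 C],
      [/\ unif m D, unif m E & unif m G],
      [/\ cross A B, cross A C & cross B C],
      [/\ cross A D, cross B E & cross C G] &
      [/\ no_common (B :|: C :|: D), no_common (A :|: C :|: E),
          no_common (A :|: B :|: G) & [/\ A != set0, B != set0 & C != set0]]].

Lemma sys_swap A B C D E G : sys A B C D E G -> sys A C B D G E.
Proof.
case=> [[a b c] [d e g] [ab ac bc] [ad be cg] [h1 h2 h3 [a0 b0 c0]]].
by split; split=> //; [exact: crossC|rewrite setUC (setUC C) setUC].
Qed.

Lemma sys_rot A B C D E G : sys A B C D E G -> sys B C A E G D.
Proof.
case=> [[a b c] [d e g] [ab ac bc] [ad be cg] [h1 h2 h3 [a0 b0 c0]]].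
split; split=> //; try exact: crossC.
  by rewrite (setUC C).
by rewrite (setUC B).
Qed.

Definition total_card A B C D E G := #|A| + #|B| + #|C| + #|D| + #|E| + #|G|.

Hypotheses (m_ge : 11 <= m) (M_ge : 18 * m + 33 <= M).

Let u := 'C(M, m.-1).

Definition good E B :=
  #|E| + #|B| + 'C(M - m.+1, m) <= 'C(M, m) + 1 /\
  (1 < #|B| -> #|E| + #|B| + 2 * 'C(M - m.+1, m) <= 'C(M, m) + 'C(M - m.+2, m) + 2).

Definition bad E B := 3 * u < #|B| /\ #|E| <= u.

Lemma good_or_bad E B : cross B E -> unif m.+1 B -> unif m E -> B != set0 ->
  good E B \/ bad E B.
Proof.
move=> c uB uE B0.
have hM : m + m.+1 <= M by lia.
have m3 : 3 <= m by lia.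
case: (cross_good_or_small (crossC c) uE uB hM m3 B0) => [h|h]; first by left.
case: (leqP #|B| (3 * u)) => hB; last by right.
have := gamma_small m_ge M_ge; rewrite -/u in h *.
have : 'C(M - m.+2, m) <= 'C(M - m.+1, m) by rewrite leq_bin2l //; lia.
by left; split; lia.
Qed.

Lemma sys_member A B C D E G x : sys A B C D E G ->
  exists Z : {set 'I_M}, [/\ x \notin Z, #|Z| <= m.+1 & forall X, X \in A -> X :&: Z != set0].
Proof.
case=> [[a b c] [d e g] [ab ac bc] [ad be cg] [h1 h2 h3 _]].
have [Z hZ xZ] := h1 x; exists Z; split=> //; move: hZ; rewrite !inE => /orP[/orP[]|] hZ.
- by rewrite b.
- by rewrite c.
- by rewrite d.
- by move=> X hX; apply: ab.
- by move=> X hX; apply: ac.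
- by move=> X hX; apply: ad.
Qed.

Lemma sys_good A B C D E G : sys A B C D E G -> good E B -> good G C ->
  total_card A B C D E G + 'C(M - m, m.+1) + 'C(M - m.+1, m.+1) + 2 * 'C(M - m.+1, m)
  <= 'C(M, m.+1) + 'C(M - (m + m.+1), m.+1) + 2 * 'C(M, m) + 3.
Proof.
move=> s gB gC; have hZ := fun x => sys_member x s.
case: s => [[uA uB uC] [uD uE uG] [ab ac bc] [ad be cg] [h1 h2 h3 [A0 B0 C0]]].
have cT : #|[set: 'I_M]| = M by rewrite cardsT card_ord.
have subT (P : {set {set 'I_M}}) Y : Y \in P -> Y \subset setT by rewrite subsetT.
case: (set_0Vmem D) => [D0|[d hd]]; last first.
  have hU : m.+1 + m.+1 + m < #|[set: 'I_M]| by rewrite cT; lia.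
  have m0 : 0 < m by lia.
  have := star_trade (subT A) (subT D) ad uA uD hd (leqnn m) m0 hU (fun x _ => hZ x) (fun _ => A0).
  have -> : #|[set: 'I_M]| - m.+1 - m = M - (m + m.+1) by rewrite cT; lia.
  rewrite cT; case: gB => gB _; case: gC => gC _; rewrite /total_card; slia.
have [b hb] := set0Pn _ B0; have [c hc] := set0Pn _ C0.
have [x /setIP[xb xc]] := set0Pn _ (bc _ _ hb hc).
have fin Y Y' (P Q : {set {set 'I_M}}) : Y \in P -> Y' \in Q -> cross A P -> cross A Q -> cross P Q ->
    unif m.+1 P -> unif m.+1 Q -> Y != Y' ->
    #|A| + 3 * 'C(M - m.+1, m.+1) <= 'C(M, m.+1) + 'C(M - m.+2, m.+1) + 'C(M - (m + m.+1), m.+1).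
  move=> hY hY' cP cQ cPQ uP uQ neq.
  have hU : m.+1 + m.+1 <= #|[set: 'I_M]| by rewrite cT; lia.
  have := star_bound (subT A) uA (subsetT Y) (subsetT Y') (uP _ hY) (uQ _ hY') neq
    (cPQ _ _ hY hY') hU (fun X h => cP X Y h hY) (fun X h => cQ X Y' h hY') hZ.
  by rewrite cT.
have e1 : 'C(M - m, m.+1) = 'C(M - m.+1, m.+1) + 'C(M - m.+1, m).
  by rewrite -binS subnSK //; lia.
have e2 : 'C(M - m.+1, m.+1) = 'C(M - m.+2, m.+1) + 'C(M - m.+2, m).
  by rewrite -binS subnSK //; lia.

have two (P : {set {set 'I_M}}) Y Y' : Y \in P -> Y' \in P -> Y != Y' -> 1 < #|P|.
  move=> hY hY' neq; have : [set Y; Y'] \subset P by rewrite subUset !sub1set hY.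
  by move/subset_leq_card; rewrite cards2 neq.
have [Y] := h1 x; rewrite D0 setU0 inE => /orP[] hY xY.
- have nc : Y != c by apply: contraNneq xY => ->.
  have nb : Y != b by apply: contraNneq xY => ->.
  have := fin _ _ _ _ hY hc ab ac bc uB uC nc.
  case: gB => _ /(_ (two _ _ _ hY hb nb)); case: gC => gC _; rewrite /total_card cards0; slia.
- have nc : Y != c by apply: contraNneq xY => ->.
  have nb : Y != b by apply: contraNneq xY => ->.
  have := fin _ _ _ _ hY hb ac ab (crossC bc) uC uB nb.
  case: gC => _ /(_ (two _ _ _ hY hc nc)); case: gB => gB _; rewrite /total_card cards0; slia.
Qed.

Lemma sys_star A B C D E G x : sys A B C D E G ->
  #|star x A| + 'C(M - m.+1, m) <= 'C(M, m).
Proof.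
move=> s; have [Z [xZ cZ AZ]] := sys_member x s.
case: s => [[uA _ _] _ _ _ _].
have subT Y : Y \in A -> Y \subset setT by rewrite subsetT.
have := star_hit subT uA (in_setT x) xZ cZ AZ; rewrite cardsT card_ord.
have -> : M.-1 - m.+1 = (M - m.+1).-1 by lia.
have M0 : 0 < M by lia.
have M1 : 0 < M - m.+1 by lia.
have m0 : 0 < m by lia.
have e1 := bin_pred M0 m0; have e2 := bin_pred M1 m0.
have : 'C((M - m.+1).-1, m.-1) <= 'C(M.-1, m.-1) by rewrite leq_bin2l //; lia.
slia.
Qed.

Lemma sys_pair A B C D E G : sys A B C D E G -> #|D| + 'C(M - m.+1, m) <= 'C(M, m).
Proof.
case=> [[uA _ _] [uD _ _] _ [ad _ _] [_ _ _ [A0 _ _]]].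
have [a ha] := set0Pn _ A0.
have := card_hits m (subsetT a); rewrite cardsT card_ord (uA _ ha) => <-.
rewrite leq_add2r; apply/subset_leq_card/subsetP=> Y hY.
by rewrite inE subsetT (uD _ hY) eqxx /= setIC ad.
Qed.

Lemma unif_bound p P : unif p P -> #|P| <= 'C(M, p).
Proof.
move=> uP; have := cards_draws [set: 'I_M] p; rewrite cardsT card_ord => <-.
by apply/subset_leq_card/subsetP=> Y hY; rewrite inE subsetT (uP _ hY) /=.
Qed.

Lemma del_bound p x P : unif p.+1 P -> #|star x P| <= 'C(M, p).
Proof. by move=> uP; rewrite -card_del; apply/unif_bound/del_unif. Qed.

Lemma sys_pair_cover_half A B C D E G i j : i != j -> sys A B C D E G -> #|E| <= u ->
  (forall Y, Y \in B :|: C :|: D -> (i \in Y) || (j \in Y)) ->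
  u < #|[set X in B | (i \in X) && (j \notin X)]| ->
  total_card A B C D E G + 5 * 'C(M - m.+1, m) <= 5 * 'C(M, m) + 6 * u.
Proof.
move=> ij s hE cov hB.
have sB := sys_rot s; have sC := sys_rot sB.
have A1 := sys_star i s; have B1 := sys_star i sB; have B2 := sys_star j sB.
have C1 := sys_star i sC; have G1 := sys_pair sC.
case: s => [[uA uB uC] [uD uE uG] [ab ac bc] [ad be cg] _].
pose B' := [set X in B | (i \in X) && (j \notin X)].
pose P := del i B'.
have hP : u < #|P|.
  rewrite card_del; apply: leq_trans hB _; apply/subset_leq_card/subsetP=> X.
  by rewrite !inE => /andP[-> /andP[-> ->]].
have uP : unif m P by apply: del_unif => X; rewrite inE => /andP[/uB].
have small q Q : cross Q P -> unif q Q -> q <= m.+1 -> #|Q| <= u.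
  move=> cQ uQ qm.
  have h1 : q + m <= 2 * m.-1 + 3 by lia.
  have h2 : m.-1 + q <= M by lia.
  have h3 : m.-1 + m <= M by lia.
  have [//|] := cross_small cQ uQ uP h1 h2 h3.
  by rewrite -/u leqNgt hP.
have crossP (R : {set {set 'I_M}}) Z Y : cross R B -> Z \in R -> i \notin Z -> Y \in P ->
    exists y, [/\ y \in Z, y \in Y & y != j].
  move=> cR hZ iZ /imsetP[W]; rewrite !inE => /andP[/andP[hW /andP[iW jW]] _] ->.
  have [y /setIP[yZ yW]] := set0Pn _ (cR _ _ hZ hW).
  exists y; split=> //; last by apply: contraNneq jW => <-.
  by rewrite !inE yW andbT; apply: contraNneq iZ => <-.
have half (R : {set {set 'I_M}}) : unif m.+1 R -> cross R B ->
    #|[set X in R | (i \notin X) && (j \in X)]| <= u.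
  move=> uR cR; pose R' := [set X in R | i \notin X].
  have -> : [set X in R | (i \notin X) && (j \in X)] = star j R'.
    by apply/setP=> X; rewrite !inE andbA.
  rewrite -card_del; apply: (small m) => //; last first.
    by apply: del_unif => X; rewrite inE => /andP[/uR].
  move=> X Y /imsetP[Z]; rewrite !inE => /andP[/andP[hZ iZ] jZ] -> hY.
  have [y [yZ yY yj]] := crossP _ _ _ cR hZ iZ hY.
  by apply/set0Pn; exists y; rewrite !inE yj yZ.
have split2 (R : {set {set 'I_M}}) : (forall Y, Y \in R -> (i \in Y) || (j \in Y)) ->
    #|R| <= #|star i R| + #|[set X in R | (i \notin X) && (j \in X)]|.
  move=> cR; rewrite (card_split i R) leq_add2l; apply/subset_leq_card/subsetP=> X.
  by rewrite !inE => /andP[hX iX]; have := cR _ hX; rewrite hX (negbTE iX).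
have hB2 : #|B| <= #|star i B| + #|[set X in B | (i \notin X) && (j \in X)]|.
  by apply: split2 => Y hY; apply: cov; rewrite !inE hY.
have hC2 : #|C| <= #|star i C| + #|[set X in C | (i \notin X) && (j \in X)]|.
  by apply: split2 => Y hY; apply: cov; rewrite !inE hY orbT.
have hD2 : #|D| <= #|star i D| + #|[set X in D | (i \notin X) && (j \in X)]|.
  by apply: split2 => Y hY; apply: cov; rewrite !inE hY orbT.
have {}hB2 : #|B| <= #|star i B| + #|star j B|.
  apply: leq_trans hB2 _.
  rewrite leq_add2l; apply/subset_leq_card/subsetP=> X.
  by rewrite !inE => /andP[-> /andP[]].
have {}hC2 : #|C| <= #|star i C| + u.
  apply: leq_trans hC2 _.
  by rewrite leq_add2l half //; apply: crossC.
have uD' : unif m.-1.+1 D by rewrite prednK //; lia.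
have {}hD2 : #|D| <= u + u.
  apply: leq_trans hD2 _.
  apply: leq_add; first exact: del_bound.
  apply: leq_trans (del_bound j uD'); apply/subset_leq_card/subsetP=> X.
  by rewrite !inE => /andP[-> /andP[]].
have hA2 : #|A| <= #|star i A| + (u + u).
  rewrite (card_split i A) leq_add2l -(cardsID [set X : {set 'I_M} | j \in X]).
  apply: leq_add.
    apply: leq_trans (half A uA ab); apply/subset_leq_card/subsetP=> X.
    by rewrite !inE -andbA.
  apply: (small m.+1) => // [X Y|X]; last by rewrite !inE => /andP[_ /andP[/uA]].
  rewrite !inE => /andP[jX /andP[hX iX]] hY.
  have [y [yZ yY yj]] := crossP _ _ _ ab hX iX hY.
  by apply/set0Pn; exists y; rewrite !inE yZ.
move: A1 B1 B2 C1 G1; rewrite /total_card; slia.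
Qed.

Lemma sys_pair_cover A B C D E G i j : i != j -> sys A B C D E G -> bad E B ->
  (forall Y, Y \in B :|: C :|: D -> (i \in Y) || (j \in Y)) ->
  total_card A B C D E G + 5 * 'C(M - m.+1, m) <= 5 * 'C(M, m) + 6 * u.
Proof.
move=> ij s [hB hE] cov.
have uB : unif m.+1 B by case: s => [[]].
pose R := star j (star i B).
have hR : #|R| <= u.
  have uD' : unif m.-1.+1 (del i B) by rewrite prednK; [exact: del_unif|lia].
  have -> : R = star i R by apply/setP=> X; rewrite !inE; case: (i \in X); rewrite ?andbT ?andbF.
  rewrite -card_del; apply: leq_trans (del_bound j uD').
  apply/subset_leq_card/subsetP=> Y /imsetP[X]; rewrite !inE.
  move=> /andP[/andP[/andP[hX iX] jX] _] ->; rewrite inE; apply/andP; split.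
    by apply: imset_f; rewrite inE hX.
  by rewrite !inE eq_sym ij.
pose Bi := [set X in B | (i \in X) && (j \notin X)].
pose Bj := [set X in B | (j \in X) && (i \notin X)].
have hBij : #|B| <= #|Bi| + #|Bj| + #|R|.
  apply: leq_trans (_ : #|Bi :|: Bj :|: R| <= _); last first.
    apply: leq_trans (leq_of_leqif (leq_card_setU _ _)) _.
    by rewrite leq_add2r (leq_of_leqif (leq_card_setU _ _)).
  apply/subset_leq_card/subsetP=> X hX; rewrite !inE hX /=.
  have : (i \in X) || (j \in X) by apply: cov; rewrite !inE hX.
  by case: (i \in X); case: (j \in X).
case: (ltnP u #|Bi|) => hi; first exact: (sys_pair_cover_half ij s hE cov hi).
have hj : u < #|Bj| by slia.
rewrite eq_sym in ij; apply: (sys_pair_cover_half ij s hE _ hj) => Y /cov.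
by rewrite orbC.
Qed.

Lemma visits_bound x B : x = 0 :> nat -> unif m.+1 B -> (forall Y, Y \in B -> visits m Y) ->
  #|B| <= #|star x B| + u.
Proof.
move=> x0 uB vB; rewrite (card_split x B) leq_add2l.
pose B0 := [set X in B | x \notin X].
have xB0 X : X \in B0 -> [/\ X \in B & x \notin X] by rewrite inE => /andP.
rewrite -(card_in_imset (f := fun X : {set 'I_M} => x |: X) (D := B0)); last first.
  move=> X Y /xB0[_ xX] /xB0[_ xY] e.
  by rewrite -(setU1K xX) e setU1K.
apply: (@visits_card _ _ m.-1 m.+2); last lia.
  by move=> Y /imsetP[X /xB0[hX xX] ->]; rewrite cardsU1 xX (uB _ hX).
move=> Y /imsetP[X /xB0[hX xX] ->].
have [l lM hl] := vB _ hX; exists l => //.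
have cl := card_flip X lM; rewrite (uB _ hX) in cl.
have l0 : 0 < l by rewrite lt0n; apply: contraTneq hl => l0; move: cl; rewrite l0 cnt0; lia.
have := card_flip (x |: X) lM; rewrite cardsU1 xX (uB _ hX).
have -> : cnt (x |: X) l = (cnt X l).+1.
  rewrite /cnt (cardsD1 x) !inE eqxx x0 l0 /= add1n; congr _.+1; apply: eq_card => y.
  by rewrite !inE; case: eqVneq => [->|_] //=; rewrite (negbTE xX).
lia.
Qed.

Lemma sys_stable A B C D E G : stable A -> stable B -> sys A B C D E G ->
  bad D A -> bad E B ->
  total_card A B C D E G + 5 * 'C(M - m.+1, m) <= 5 * 'C(M, m) + 6 * u.
Proof.
move=> sA sB s [hA hD] [hB hE].
have M0 : 0 < M by lia.
pose x := Ordinal M0.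
have s1 := sys_rot s; have s2 := sys_rot s1.
have A1 := sys_star x s; have B1 := sys_star x s1; have C1 := sys_star x s2.
have G1 := sys_pair s2.
case: s => [[uA uB uC] [uD uE uG] [ab ac bc] [ad be cg] _].
have vis P Q : u < #|Q| -> stable Q -> unif m.+1 Q -> unif m.+1 P -> cross Q P ->
    forall Y, Y \in P -> visits m Y.
  move=> hQ sQ uQ uP c.
  have hst : m.+1 + m.+1 <= m.-1 + m + 3 by lia.
  have [h|//] := visits_dichotomy sQ c uP uQ hst.
  have hM : m.-1 + m.+1 <= M by lia.
  by have := visits_card uQ h hM; rewrite leqNgt hQ.
have hA' : u < #|A| by slia.
have hB' : u < #|B| by slia.
have A2 := @visits_bound x A erefl uA (vis _ _ hB' sB uB uA (crossC ab)).
have B2 := @visits_bound x B erefl uB (vis _ _ hA' sA uA uB ab).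
have C2 := @visits_bound x C erefl uC (vis _ _ hA' sA uA uC ac).
have : 'C(M - m.+1, m) <= 'C(M, m) by rewrite leq_bin2l //; lia.
rewrite /total_card; slia.
Qed.

Lemma mem_sh i j P Y x : x \in sh i j P Y -> x \in Y \/ x = i /\ j \in Y.
Proof.
rewrite /sh; case: ifP => [/and3P[jY _ _]|_]; last by left.
by rewrite !inE => /orP[/eqP->|/andP[_ ->]]; [right|left].
Qed.

Lemma no_common_shift i j B C D : no_common (B :|: C :|: D) ->
  no_common (shift i j B :|: shift i j C :|: shift i j D) \/
  (forall Y, Y \in B :|: C :|: D -> (i \in Y) || (j \in Y)).
Proof.
move=> nc; set S := _ :|: _ :|: shift i j D.
case: (boolP [forall x, exists Y in S, x \notin Y]) => [/forallP h|].
  by left=> x; have /existsP[Y /andP[hY xY]] := h x; exists Y.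
rewrite negb_forall => /existsP[x]; rewrite negb_exists => /forallP h; right.
have hS Y : Y \in B :|: C :|: D -> exists P, x \in sh i j P Y.
  have aux2 P : shift i j P \subset S -> Y \in P -> x \in sh i j P Y.
    move=> sub hY; have := h (sh i j P Y).
    by rewrite (subsetP sub) ?imset_f //= negbK.
  rewrite !inE => /orP[/orP[]|] hY.
  - by exists B; apply: aux2 => //; apply/subsetP=> Z hZ; rewrite /S !inE hZ ?orbT.
  - by exists C; apply: aux2 => //; apply/subsetP=> Z hZ; rewrite /S !inE hZ ?orbT.
  - by exists D; apply: aux2 => //; apply/subsetP=> Z hZ; rewrite /S !inE hZ ?orbT.
have xi : x = i.
  have [Y hY xY] := nc x; have [P /mem_sh[|[]//]] := hS _ hY.
  by rewrite (negbTE xY).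
move=> Y /hS[P /mem_sh[]]; first by rewrite xi => ->.
by case=> _ ->; rewrite orbT.
Qed.

Lemma sys_two_bad A B C D E G : sys A B C D E G -> bad D A -> bad E B ->
  total_card A B C D E G + 5 * 'C(M - m.+1, m) <= 5 * 'C(M, m) + 6 * u.
Proof.
have [k] := ubnP (mu A + mu B).
elim: k => // k IH in A B C D E G *; rewrite ltnS => hk s bA bB.
have step i j : i < j -> mu (shift i j A) + mu (shift i j B) < mu A + mu B ->
    total_card A B C D E G + 5 * 'C(M - m.+1, m) <= 5 * 'C(M, m) + 6 * u.
  move=> ij hmu; have ij' : i != j by rewrite -val_eqE /= ltn_eqF.
  have s1 := sys_rot s; have s2 := sys_rot s1.
  have sw := sys_swap s1.
  case: (s) => [[uA uB uC] [uD uE uG] [ab ac bc] [ad be cg] [h1 h2 h3 [A0 B0 C0]]].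
  case: (no_common_shift i j h1) => [n1|]; last exact: sys_pair_cover.
  case: (no_common_shift i j h2) => [n2|cov]; last first.
    have := sys_pair_cover ij' sw bA cov; rewrite /total_card; slia.
  case: (no_common_shift i j h3) => [n3|cov]; last first.
    have := sys_pair_cover ij' s2 bA cov; rewrite /total_card; slia.
  have nz P : P != set0 -> shift i j P != set0 by rewrite -!card_gt0 card_shift.
  have s' : sys (shift i j A) (shift i j B) (shift i j C) (shift i j D) (shift i j E) (shift i j G).
    split; split; rewrite ?nz //; try exact: shift_unif; exact: shift_cross.
  have := IH _ _ _ _ _ _ (leq_trans hmu hk) s'.
  by rewrite /bad /total_card !card_shift; apply.
case: (stable_or_shift A) => [sA|[i [j [ij h]]]]; last first.
  by apply: (step i j) => //; have := mu_shift B ij; lia.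
case: (stable_or_shift B) => [sB|[i [j [ij h]]]]; last first.
  by apply: (step i j) => //; have := mu_shift A ij; lia.
exact: sys_stable.
Qed.

Lemma sys_bound A B C D E G : sys A B C D E G ->
  total_card A B C D E G + 'C(M - m, m.+1) + 'C(M - m.+1, m.+1) + 2 * 'C(M - m.+1, m)
  <= 'C(M, m.+1) + 'C(M - (m + m.+1), m.+1) + 2 * 'C(M, m) + 3.
Proof.
move=> s; have s1 := sys_rot s; have s2 := sys_rot s1.
case: (s) => [[uA uB uC] [uD uE uG] [ab ac bc] [ad be cg] [_ _ _ [A0 B0 C0]]].
have num T : T + 5 * 'C(M - m.+1, m) <= 5 * 'C(M, m) + 6 * u ->
    T + 'C(M - m, m.+1) + 'C(M - m.+1, m.+1) + 2 * 'C(M - m.+1, m)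
    <= 'C(M, m.+1) + 'C(M - (m + m.+1), m.+1) + 2 * 'C(M, m) + 3.
  have h1 := gamma_small m_ge M_ge; have h2 := hit_large m_ge M_ge.
  have : 'C(M - m.+2, m) <= 'C(M - m.+1, m) by rewrite leq_bin2l //; lia.
  rewrite -/u in h1; lia.
have t1 : total_card B C A E G D = total_card A B C D E G by rewrite /total_card; slia.
have t2 : total_card C A B G D E = total_card A B C D E G by rewrite /total_card; slia.
case: (good_or_bad ad uA uD A0) => hA; case: (good_or_bad be uB uE B0) => hB;
  case: (good_or_bad cg uC uG C0) => hC.
- exact: sys_good.
- by rewrite -t2; apply: sys_good.
- by rewrite -t1; apply: sys_good.
- by apply: num; rewrite -t1; apply: sys_two_bad.
- exact: sys_good.
- by apply: num; rewrite -t2; apply: sys_two_bad.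
- by apply: num; apply: sys_two_bad.
- by apply: num; apply: sys_two_bad.
Qed.
End SixFamilies.

Lemma card_supersets (T : finType) (U S : {set T}) k : S \subset U -> #|S| <= k ->
  #|[set Y : {set T} | [&& S \subset Y, Y \subset U & #|Y| == k]]| = 'C(#|U| - #|S|, k - #|S|).
Proof.
move=> SU Sk; rewrite -(cardsDS SU) -cards_draws.
have disj (Z : {set T}) : Z \subset U :\: S -> Z :&: S = set0.
  by rewrite subsetD => /andP[_]; rewrite -setI_eq0 => /eqP.
rewrite -(card_in_imset (f := fun Z : {set T} => Z :|: S)
  (D := [set A : {set T} | (A \subset U :\: S) && (#|A| == k - #|S|)])); last first.
  move=> Z Z'; rewrite !inE => /andP[/disj d _] /andP[/disj d' _] e.
  have aux (V : {set T}) : V :&: S = set0 -> (V :|: S) :\: S = V.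
    by move=> h; rewrite setDUl setDv setU0 setDE; apply/setIidPl; rewrite -disjoints_subset -setI_eq0 h.
  by rewrite -(aux Z d) e aux.
apply: eq_card => Y; rewrite inE; apply/and3P/imsetP => [[SY YU /eqP cY]|[Z]].
  exists (Y :\: S); last by rewrite setUC -{1}(setIidPr SY) setID.
  by rewrite inE setSD // cardsDS // cY eqxx.
rewrite inE => /andP[h /eqP cZ] ->; have d := disj _ h.
split; first exact: subsetUr.
  by rewrite subUset SU andbT; apply: subset_trans h (subsetDl _ _).
by rewrite cardsU d cards0 cZ subn0 subnK.
Qed.

Lemma subset_between (T : finType) (U S : {set T}) k : S \subset U -> #|S| <= k -> k <= #|U| ->
  exists Y : {set T}, [/\ S \subset Y, Y \subset U & #|Y| = k].
Proof.
move=> SU Sk kU.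
have : 0 < #|[set Y : {set T} | [&& S \subset Y, Y \subset U & #|Y| == k]]|.
  by rewrite card_supersets // bin_gt0 leq_sub2r.
by rewrite card_gt0 => /set0Pn[Y]; rewrite inE => /and3P[h1 h2 /eqP h3]; exists Y.
Qed.

(** * Traces on a triple, and the upper bound *)

Section Traces.
Variables (n m : nat) (F : {set {set 'I_n}}) (a b c : 'I_n).
Hypotheses (ab : a != b) (ac : a != c) (bc : b != c).
Hypotheses (uF : unif m.+2 F) (cF : cross F F).

Let T := [set a; b; c].

Definition trace (x y z : bool) : {set {set 'I_n}} :=
  [set X in F | [&& (a \in X) == x, (b \in X) == y & (c \in X) == z]].

Lemma card_triple : #|T| = 3.
Proof. by rewrite /T -setUA cardsU1 cards2 bc !inE negb_or ab ac. Qed.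

Lemma card_traces : #|F| =
  #|trace true false false| + #|trace false true false| + #|trace false false true|
  + #|trace false true true| + #|trace true false true| + #|trace true true false|
  + (#|trace false false false| + #|trace true true true|).
Proof.
have sp (d : 'I_n) (P : {set {set 'I_n}}) :
  #|P| = #|[set X in P | (d \in X) == true]| + #|[set X in P | (d \in X) == false]|.
  rewrite (card_split d P); congr (_ + _); apply: eq_card => X; rewrite !inE;
  by case: (d \in X); rewrite ?andbT ?andbF.
have e x y z : #|trace x y z| = #|[set X in [set X in [set X in F | (a \in X) == x] |
    (b \in X) == y] | (c \in X) == z]|.
  by apply: eq_card => X; rewrite !inE !andbA.
rewrite !e (sp a F) (sp b [set X in F | (a \in X) == true]) (sp b [set X in F | (a \in X) == false]).
rewrite (sp c [set X in [set X in F | (a \in X) == true] | (b \in X) == true]).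
rewrite (sp c [set X in [set X in F | (a \in X) == true] | (b \in X) == false]).
rewrite (sp c [set X in [set X in F | (a \in X) == false] | (b \in X) == true]).
rewrite (sp c [set X in [set X in F | (a \in X) == false] | (b \in X) == false]).
slia.
Qed.

Let g : 'I_#|~: T| -> 'I_n := enum_val.

Let g_inj : injective g. Proof. exact: enum_val_inj. Qed.

Let gT : g @: setT = ~: T.
Proof.
apply/setP=> x; apply/imsetP/idP=> [[i _ ->]|xU]; first exact: enum_valP.
by exists (enum_rank_in xU x) => //; rewrite /g enum_rankK_in.
Qed.

Let gN i : (g i == a = false) * (g i == b = false) * (g i == c = false).
Proof.
have : g i \in ~: T by rewrite -gT imset_f.
by rewrite !inE !negb_or -andbA => /and3P[/negbTE-> /negbTE-> /negbTE->].
Qed.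

Definition link x y z := [set g @^-1: (X : {set 'I_n}) | X in trace x y z].

Lemma card_link x y z : #|link x y z| = #|trace x y z|.
Proof.
apply: card_in_imset => X Y; rewrite !inE.
move=> /andP[_ /and3P[/eqP xa /eqP xb /eqP xc]] /andP[_ /and3P[/eqP ya /eqP yb /eqP yc]] e.
apply/setP=> p; case: (boolP (p \in T)) => [|pT].
  by rewrite !inE => /orP[/orP[]|] /eqP->; rewrite ?xa ?xb ?xc ?ya ?yb ?yc.
have : p \in ~: T by rewrite inE.
rewrite -gT => /imsetP[i _ ->].
by have := congr1 (fun X : {set 'I_#|~: T|} => i \in X) e; rewrite /= !inE.
Qed.

Lemma link_unif (x y z : bool) : unif (m.+2 - (x + y + z)) (link x y z).
Proof.
move=> Y /imsetP[X]; rewrite inE => /andP[hX /and3P[/eqP xa /eqP xb /eqP xc]] ->.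
rewrite (card_preim_inj g_inj) gT -setDE cardsD (uF hX); congr (_ - _).
rewrite (cardsD1 a (X :&: T)) (cardsD1 b (_ :\ a)) (cardsD1 c (_ :\ b)).
have -> : X :&: T :\ a :\ b :\ c = set0.
  apply/setP=> p; rewrite !inE.
  by case: (p == a); case: (p == b); case: (p == c); rewrite ?andbF.
rewrite cards0 !inE !eqxx xa xb xc (eq_sym b a) (eq_sym c a) (eq_sym c b).
by rewrite (negbTE ab) (negbTE ac) (negbTE bc) /= ?orbT ?andbT addn0 addnA.
Qed.

Lemma link_cross x y z x' y' z' : ~~ (x && x') -> ~~ (y && y') -> ~~ (z && z') ->
  cross (link x y z) (link x' y' z').
Proof.
move=> hx hy hz V W /imsetP[X hX ->] /imsetP[Y hY ->]; rewrite -preimsetI.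
move: hX hY; rewrite !inE => /andP[hX /and3P[/eqP xa /eqP xb /eqP xc]].
move=> /andP[hY /and3P[/eqP ya /eqP yb /eqP yc]].
have [p hp] := set0Pn _ (cF hX hY); apply: (preim_neq0 g_inj hp).
rewrite gT; move: hp; rewrite inE => /andP[pX pY]; rewrite !inE.
apply/negP=> /orP[/orP[]|] /eqP e; rewrite e in pX pY.
- by rewrite -xa -ya pX pY in hx.
- by rewrite -xb -yb pX pY in hy.
- by rewrite -xc -yc pX pY in hz.
Qed.

Hypothesis only : forall p, p \in T -> exists2 X, X \in F & X :&: T = [set p].
Hypothesis avoid : forall p q, p \in T -> q \notin T ->
  exists X, [/\ X \in F, p \notin X, q \notin X & X :&: T != set0].
Hypothesis ends : #|trace false false false| + #|trace true true true| <= 'C(n - 3, m.-1).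
Hypotheses (m_ge : 11 <= m) (n_ge : 18 * m + 36 <= n).

Lemma link_no_common p (P : {set {set 'I_#|~: T|}}) : p \in T ->
  (forall X, X \in F -> p \notin X -> X :&: T != set0 -> g @^-1: X \in P) ->
  no_common P.
Proof.
move=> pT h i; have giT : g i \notin T by rewrite !inE !gN.
have [X [hX pX iX XT]] := avoid pT giT.
by exists (g @^-1: X); [exact: h|rewrite inE].
Qed.

Lemma card_compl : #|~: T| = n - 3.
Proof. by have := cardsC T; rewrite card_triple card_ord; lia. Qed.

Lemma link_sys : sys m
  (link true false false) (link false true false) (link false false true)
  (link false true true) (link true false true) (link true true false).
Proof.
have u1 (x y z : bool) : x + y + z = 1 -> unif m.+1 (link x y z).
  by move=> e Y /link_unif; rewrite e; lia.
have u2 (x y z : bool) : x + y + z = 2 -> unif m (link x y z).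
  by move=> e Y /link_unif; rewrite e; lia.
have inl X : X \in F -> g @^-1: X \in link (a \in X) (b \in X) (c \in X).
  by move=> hX; apply: imset_f; rewrite inE hX !eqxx.
have some X : X :&: T != set0 -> [|| a \in X, b \in X | c \in X].
  case/set0Pn=> q; rewrite !inE => /andP[qX /orP[/orP[]|] /eqP e];
  by rewrite -e qX ?orbT.
have nz p : p \in T -> exists X : {set 'I_n}, [/\ g @^-1: X \in link (a \in X) (b \in X) (c \in X),
    (a \in X) = (p == a), (b \in X) = (p == b) & (c \in X) = (p == c)].
  move=> pT; have [X hX e] := only pT; exists X.
  have aux q : q \in T -> (q \in X) = (p == q).
    move=> qT; have := congr1 (fun X : {set 'I_n} => q \in X) e.
    by rewrite /= in_setI qT andbT inE eq_sym.
  by split; [exact: inl|..]; apply: aux; rewrite !inE eqxx ?orbT.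
have aT : a \in T by rewrite !inE eqxx.
have bT : b \in T by rewrite !inE eqxx orbT.
have cT : c \in T by rewrite !inE eqxx orbT.
split; split; try exact: u1; try exact: u2; try exact: link_cross.
- apply: (link_no_common aT) => X hX aX /some; have := inl _ hX.
  rewrite (negbTE aX) /=; case: (b \in X); case: (c \in X) => // h _; rewrite !in_setU h ?orbT //.
- apply: (link_no_common bT) => X hX bX /some; have := inl _ hX.
  rewrite (negbTE bX) /=; case: (a \in X); case: (c \in X) => // h _; rewrite !in_setU h ?orbT //.
- apply: (link_no_common cT) => X hX cX /some; have := inl _ hX.
  rewrite (negbTE cX) /=; case: (a \in X); case: (b \in X) => // h _; rewrite !in_setU h ?orbT //.
split.
- have [X [h ea eb ec]] := nz _ aT; apply/set0Pn; exists (g @^-1: X).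
  by move: h; rewrite ea eb ec eqxx (negbTE ab) (negbTE ac).
- have [X [h ea eb ec]] := nz _ bT; apply/set0Pn; exists (g @^-1: X).
  by move: h; rewrite ea eb ec eqxx (negbTE bc) eq_sym (negbTE ab).
- have [X [h ea eb ec]] := nz _ cT; apply/set0Pn; exists (g @^-1: X).
  by move: h; rewrite ea eb ec eqxx ![c == _]eq_sym (negbTE ac) (negbTE bc).
Qed.

Lemma trace_bound :
  #|F| + 'C(n - m - 3, m.+1) + 'C(n - m - 4, m.+1) + 2 * 'C(n - m - 4, m)
  <= 'C(n.-1, m.+1) + 'C(n - 2 * m.+2, m.+1) + 3.
Proof.
have hM : 18 * m + 33 <= #|~: T| by rewrite card_compl; lia.
have hT : total_card (link true false false) (link false true false) (link false false true)
    (link false true true) (link true false true) (link true true false)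
    + (#|trace false false false| + #|trace true true true|) = #|F|.
  rewrite card_traces /total_card.
  have := card_link true false false; have := card_link false true false.
  have := card_link false false true; have := card_link false true true.
  have := card_link true false true; have := card_link true true false.
  slia.
have := sys_bound m_ge hM link_sys; move: hT; move: (total_card _ _ _ _ _ _) => t hT.
rewrite card_compl -hT.
have -> : n - m - 3 = n - 3 - m by lia.
have -> : n - m - 4 = n - 3 - m.+1 by lia.
have -> : n - 2 * m.+2 = n - 3 - (m + m.+1) by lia.
have e1 : 'C(n.-1, m.+1) = 'C(n.-1.-1, m.+1) + 'C(n.-1.-1, m).
  by rewrite bin_pred //; lia.
have e2 : 'C(n.-1.-1, m.+1) = 'C(n - 3, m.+1) + 'C(n - 3, m).
  by rewrite bin_pred //; [congr ('C(_, _) + 'C(_, _)); lia|lia].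
have e3 : 'C(n.-1.-1, m) = 'C(n - 3, m) + 'C(n - 3, m.-1).
  by rewrite bin_pred //; [congr ('C(_, _) + 'C(_, _)); lia|lia|lia].
move: ends; slia.
Qed.
End Traces.

Section UpperBound.
Variables n m : nat.
Hypotheses (m_ge : 11 <= m) (n_ge : 18 * m + 36 <= n).
Implicit Types (F : {set {set 'I_n}}) (p q : 'I_n).

Definition no_cover2 F := forall p q, exists X, [/\ X \in F, p \notin X & q \notin X].

Lemma card_full_trace F (a b c : 'I_n) : a != b -> a != c -> b != c -> unif m.+2 F ->
  #|trace F a b c true true true| <= 'C(n - 3, m.-1).
Proof.
move=> ab ac bc uF; have c3 := card_triple ab ac bc.
have Tm : #|[set a; b; c]| <= m.+2 by rewrite c3; lia.
have := card_supersets (subsetT [set a; b; c]) Tm.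
rewrite c3 cardsT card_ord; have -> : m.+2 - 3 = m.-1 by lia.
move=> <-; apply/subset_leq_card/subsetP=> X.
rewrite inE => /andP[hX /and3P[/eqP h1 /eqP h2 /eqP h3]].
by rewrite inE subsetT (uF _ hX) eqxx !subUset !sub1set h1 h2 h3.
Qed.

Lemma covered_bound F (a b c : 'I_n) : unif m.+2 F -> cross F F -> no_cover2 F ->
  (forall X, X \in F -> [|| a \in X, b \in X | c \in X]) ->
  #|F| + 'C(n - m - 3, m.+1) + 'C(n - m - 4, m.+1) + 2 * 'C(n - m - 4, m)
  <= 'C(n.-1, m.+1) + 'C(n - 2 * m.+2, m.+1) + 3.
Proof.
move=> uF cF nc cov.
have ab : a != b.
  apply/eqP=> e; have [X [hX aX cX]] := nc a c.
  by have := cov _ hX; rewrite -e (negbTE aX) (negbTE cX).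
have ac : a != c.
  apply/eqP=> e; have [X [hX aX bX]] := nc a b.
  by have := cov _ hX; rewrite -e (negbTE aX) (negbTE bX).
have bc : b != c.
  apply/eqP=> e; have [X [hX aX bX]] := nc a b.
  by have := cov _ hX; rewrite -e (negbTE aX) (negbTE bX).
apply: (trace_bound ab ac bc uF cF) => //.
- have aux p q r (X : {set 'I_n}) : [|| p \in X, q \in X | r \in X] -> q \notin X -> r \notin X ->
      forall S : {set 'I_n}, S = [set p; q; r] -> X :&: S = [set p].
    move=> h qX rX S ->; apply/setP=> x; rewrite !inE.
    rewrite (negbTE qX) (negbTE rX) !orbF in h.
    case: (eqVneq x p) => [->|_]; first by rewrite h.
    case: (eqVneq x q) => [->|_]; first by rewrite (negbTE qX).
    by case: (eqVneq x r) => [->|_]; rewrite ?(negbTE rX) ?andbF.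
  move=> p; rewrite !inE => /orP[/orP[]|] /eqP->.
  + have [X [hX h1 h2]] := nc b c; exists X => //.
    exact: (aux _ _ _ _ (cov _ hX)).
  + have [X [hX h1 h2]] := nc a c; exists X => //.
    apply: (aux b a c) => //; first by rewrite orbCA cov.
    by rewrite [[set b; a]]setUC.
  + have [X [hX h1 h2]] := nc a b; exists X => //.
    apply: (aux c a b) => //; first by rewrite orbC -orbA cov.
    by apply/setP=> x; rewrite !inE orbC orbA.
- move=> p q _ _; have [X [hX pX qX]] := nc p q; exists X; split=> //.
  by case/or3P: (cov _ hX) => h; apply/set0Pn; [exists a|exists b|exists c]; rewrite !inE h eqxx ?orbT.
- have -> : trace F a b c false false false = set0.
    apply/setP=> X; rewrite !inE; apply/negbTE/negP=> /andP[/cov h].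
    by move: h; case: (a \in X); case: (b \in X); case: (c \in X).
  by rewrite cards0 add0n card_full_trace.
Qed.

(* The triple [{0, 1, 2}] need not be a cover here: a set missing it is reflected
   to a set containing it that is not in [F]. *)
Lemma stable_bound F : unif m.+2 F -> cross F F -> no_cover2 F -> stable F ->
  #|F| + 'C(n - m - 3, m.+1) + 'C(n - m - 4, m.+1) + 2 * 'C(n - m - 4, m)
  <= 'C(n.-1, m.+1) + 'C(n - 2 * m.+2, m.+1) + 3.
Proof.
move=> uF cF nc sF.
have n0 : 0 < n by lia. have n1 : 1 < n by lia. have n2 : 2 < n by lia.
pose a := Ordinal n0; pose b := Ordinal n1; pose c := Ordinal n2.
have ab : a != b by []. have ac : a != c by []. have bc : b != c by [].
pose T := [set a; b; c].
have memT x : (x \in T) = (x < 3) by rewrite !inE -!val_eqE /=; lia.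
have push (X : {set 'I_n}) p : X \in F -> X :&: T = set0 -> p \in T ->
    exists2 Y, Y \in F & Y :&: T = [set p] /\ Y \subset p |: X.
  move=> hX XT pT.
  have XT' x : x \in X -> x \in T = false.
    by move=> xX; apply/negP=> xT; have : x \in X :&: T; [rewrite inE xX|rewrite XT inE].
  have /set0Pn[j jX] : X != set0 by rewrite -card_gt0 (uF _ hX).
  have jT : ~~ (j < 3) by rewrite -memT XT'.
  have p3 : p < 3 by rewrite -memT.
  have pX : p \notin X by apply: contraTN pT => /XT' ->.
  exists (p |: X :\ j); first by apply: sF => //; lia.
  split; last by rewrite setUS // subsetDl.
  apply/setP=> x; rewrite in_setI in_setU1 in_setD1 in_set1.
  case: (eqVneq x p) => [->|_] /=; first exact: pT.
  by case: (boolP (x \in X)) => xX; rewrite ?andbF // XT' ?andbF.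
apply: (trace_bound ab ac bc uF cF) => //; rewrite -/T.
- have aux p q r : q \in T -> r \in T -> p \in T ->
      (forall x, x \in T -> [|| x == p, x == q | x == r]) ->
      exists2 X, X \in F & X :&: T = [set p].
    move=> qT rT pT all3; have [X [hX qX rX]] := nc q r.
    case: (boolP (p \in X)) => pX; last first.
      have [|Y hY [hT _]] := push X p hX _ pT; last by exists Y.
      apply/setP=> x; rewrite !inE; apply/negbTE/negP=> /andP[xX xT].
      have : [|| x == p, x == q | x == r] by apply: all3; rewrite !inE.
      by case/or3P=> /eqP e; move: xX; rewrite e ?(negbTE pX) ?(negbTE qX) ?(negbTE rX).
    exists X => //; apply/setP=> x; rewrite in_setI in_set1.
    case: (boolP (x \in T)) => xT; last first.
      by rewrite andbF; apply/esym/negbTE; apply: contraNneq xT => ->.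
    rewrite andbT; case: (eqVneq x p) => [->|xp]; first by rewrite pX.
    by case/or3P: (all3 _ xT) => /eqP e; [rewrite e eqxx in xp|rewrite e (negbTE qX)|rewrite e (negbTE rX)].
  have Ta : a \in T by rewrite memT. have Tb : b \in T by rewrite memT.
  have Tc : c \in T by rewrite memT.
  move=> p pT; have := pT; rewrite !inE => /orP[/orP[]|] /eqP->.
  + by apply: (aux a b c) => // x; rewrite !inE orbA.
  + by apply: (aux b a c) => // x; rewrite !inE -orbA orbCA.
  + by apply: (aux c a b) => // x; rewrite !inE orbC.
- move=> p q pT qT; have [X [hX pX qX]] := nc p q.
  case: (eqVneq (X :&: T) set0) => [e|h]; last by exists X.
  have [p' pT' pp'] : exists2 p', p' \in T & p != p'.
    case: (eqVneq p a) => [->|h]; first by exists b => //; rewrite memT.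
    by exists a => //; rewrite memT.
  have [Y hY [YT YX]] := push X p' hX e pT'; exists Y; split=> //.
  + by apply: contra pX => /(subsetP YX); rewrite in_setU1 (negbTE pp').
  + apply: contra qX => /(subsetP YX); rewrite in_setU1.
    by case: eqVneq => // e'; rewrite e' pT' in qT.
  + by rewrite YT; apply/set0Pn; exists p'; rewrite inE.
pose F0 := trace F a b c false false false.
pose F1 := trace F a b c true true true.
have c3 := card_triple ab ac bc.
have Tm : #|T| <= m.+2 by rewrite c3; lia.
have := card_supersets (subsetT T) Tm.
rewrite c3 cardsT card_ord; have -> : m.+2 - 3 = m.-1 by lia.
move=> <-.
have F0P X : X \in F0 -> [/\ X \in F, svisits m.+2 X, m.+2 + #|X| <= n & T \subset refl m.+2 X].
  rewrite inE => /andP[hX /and3P[/eqP aX /eqP bX /eqP cX]].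
  have [l ln hl] := stable_dominated sF cF hX hX.
  have hM : m.+2 + #|X| <= n by rewrite (uF _ hX); lia.
  have cl := card_flip X ln.
  have hl2 : #|flip l X| < m.+2 by move: cl; rewrite (uF _ hX); lia.
  split=> //; first by exists l.
  have [L [-> /andP[lL _] _ _]] := reflP ln (ltnW hl2) hM.
  have l3 : 3 <= l.
    rewrite leqNgt; apply/negP=> l3; suff : cnt X l = 0 by lia.
    apply/eqP; rewrite cards_eq0; apply/eqP/setP=> x; rewrite !inE.
    apply/negbTE/negP=> /andP[xX xl].
    have : x \in T by rewrite memT; lia.
    by rewrite !inE => /orP[/orP[]|] /eqP e; move: xX; rewrite e ?aX ?bX ?cX.
  apply/subsetP=> x xT; have xL : x < L by move: xT; rewrite memT; lia.
  rewrite inE xL addbT; move: xT; rewrite !inE => /orP[/orP[]|] /eqP->.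
  + by rewrite aX.
  + by rewrite bX.
  + by rewrite cX.
rewrite -(card_in_imset (f := refl m.+2) (D := F0)); last first.
  move=> X Y /F0P[hX vX bX _] /F0P[hY vY _ _].
  move=> e; have hM := bX; rewrite (uF _ hX) in hM. exact: (refl_inj (svisitsW vX) (svisitsW vY) (uF _ hX) (uF _ hY) hM e).
have d : refl m.+2 @: F0 :&: F1 = set0.
  apply/setP=> Y; rewrite in_setI in_set0; apply/negbTE/negP=> /andP[/imsetP[X /F0P[hX vX bX _] ->]].
  rewrite inE => /andP[h _]; have := refl_notin sF cF hX (svisitsW vX) bX.
  by rewrite h.
rewrite -cardsUI d cards0 addn0; apply/subset_leq_card/subsetP=> Y; rewrite in_setU.
case/orP=> [/imsetP[X /F0P[hX vX bX TX] ->]|].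
  by rewrite inE TX subsetT card_refl ?eqxx //; exact: svisitsW.
rewrite inE => /andP[hY /and3P[/eqP h1 /eqP h2 /eqP h3]].
by rewrite inE subsetT (uF _ hY) eqxx !subUset !sub1set h1 h2 h3.
Qed.

(* When shifting [j] to [i] creates a 2-cover [{i, q}], the original family has the
   3-cover [{i, j, q}]. *)
Lemma upper_bound F : unif m.+2 F -> cross F F -> no_cover2 F ->
  #|F| + 'C(n - m - 3, m.+1) + 'C(n - m - 4, m.+1) + 2 * 'C(n - m - 4, m)
  <= 'C(n.-1, m.+1) + 'C(n - 2 * m.+2, m.+1) + 3.
Proof.
have [k] := ubnP (mu F); elim: k => // k IH in F *; rewrite ltnS => hk uF cF nc.
case: (stable_or_shift F) => [sF|[i [j [ij h]]]]; first exact: stable_bound.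
case: (boolP [forall p, forall q, [exists X in shift i j F, (p \notin X) && (q \notin X)]]).
  move=> /forallP nc'.
  have := IH (shift i j F) (leq_trans h hk) (shift_unif uF) (shift_cross cF).
  rewrite card_shift; apply=> p q; have /forallP/(_ q)/existsP[X /andP[h1 /andP[h2 h3]]] := nc' p.
  by exists X.
rewrite negb_forall => /existsP[p]; rewrite negb_forall => /existsP[q].
rewrite negb_exists => /forallP hpq.
have cov X : X \in F -> (p \in sh i j F X) || (q \in sh i j F X).
  move=> hX; have := hpq (sh i j F X); rewrite imset_f //= negb_and !negbK //.
have [Y [hY pY qY]] := nc p q.
have : (p == i) || (q == i).
  by case/orP: (cov _ hY) => /mem_sh[|[-> _]]; rewrite ?(negbTE pY) ?(negbTE qY) ?eqxx ?orbT.
case/orP=> /eqP e; [apply: (@covered_bound F i j q)|apply: (@covered_bound F i j p)] => // X /cov.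
- by rewrite e => /orP[] /mem_sh[->|[_ ->]]; rewrite ?orbT.
- by rewrite e => /orP[] /mem_sh[->|[_ ->]]; rewrite ?orbT.
Qed.
End UpperBound.

(** * The family G(n, k) *)

Lemma bigminn_le (I : eqType) (r : seq I) (P : pred I) (F : I -> nat) d i :
  i \in r -> P i -> \big[minn/d]_(j <- r | P j) F j <= F i.
Proof.
elim: r => // j r IH; rewrite inE big_cons => /predU1P[->|ir] Pi.
  by rewrite Pi geq_minl.
case: ifP => _; last exact: IH.
exact: leq_trans (geq_minr _ _) (IH ir Pi).
Qed.

Section Covers.
Variable n : nat.
Implicit Types (F : {set {set 'I_n}}) (T : {set 'I_n}).

Lemma tau_le F T : is_cover F T -> tau F <= #|T|.
Proof. by move=> h; apply: bigminn_le => //; rewrite mem_index_enum. Qed.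

Lemma tau_no_cover2 F : 2 < tau F -> no_cover2 F.
Proof.
move=> hF p q; case: (boolP (is_cover F [set p; q])) => [/tau_le|].
  have : #|[set p; q]| <= 2 by rewrite cards2; case: (_ != _).
  slia.
rewrite negb_forall => /existsP[X]; rewrite negb_imply negbK => /andP[hX /eqP e].
have nX x : x \in [set p; q] -> x \notin X.
  by move=> h; apply/negP=> xX; have : x \in [set p; q] :&: X; [rewrite inE h|rewrite e inE].
by exists X; split=> //; apply: nX; rewrite !inE eqxx ?orbT.
Qed.

Lemma no_cover2_tau F : 1 < n -> no_cover2 F -> 2 < tau F.
Proof.
move=> n1 nc; rewrite /tau; elim/big_ind: _ => [|x y hx hy|T hT]; [by lia|by rewrite leq_min hx|].
rewrite ltnNge; apply/negP=> cT.
have [p [q sT]] : exists p q, T \subset [set p; q].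
  have n0 : 0 < n by lia.
  case: (set_0Vmem T) => [->|[p pT]]; first by exists (Ordinal n0), (Ordinal n0); apply: sub0set.
  case: (set_0Vmem (T :\ p)) => [e|[q qT]].
    by exists p, p; rewrite -(setD1K pT) e setU0 subsetUl.
  exists p, q; have s : [set p; q] \subset T.
    by rewrite subUset !sub1set pT; move: qT; rewrite inE => /andP[].
  have : [set p; q] == T.
    rewrite eqEcard s cards2; apply: leq_trans cT _.
    by move: qT; rewrite !inE eq_sym => /andP[->].
  by move=> /eqP->.
have [X [hX pX qX]] := nc p q.
have /forallP/(_ X) := hT; rewrite hX /= => /set0Pn[x /setIP[xT xX]].
have := subsetP sT _ xT; rewrite !inE => /orP[] /eqP e; rewrite e in xX.
  by rewrite xX in pX.
by rewrite xX in qX.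
Qed.

Lemma card_itv a b : 0 < a -> b <= n -> a <= b.+1 -> #|itv n a b| = b.+1 - a.
Proof.
move=> a0 bn ab.
have -> : itv n a b = pre n b :\: pre n a.-1 by apply/setP=> i; rewrite !inE; lia.
rewrite cardsDS ?card_pre //; try lia.
by apply/subsetP=> i; rewrite !inE; lia.
Qed.

Lemma pt_itv a : pt n a = itv n a a.
Proof. by apply/setP=> i; rewrite !inE; lia. Qed.
End Covers.

Section Gfamily.
Variables n m : nat.
Hypotheses (m_ge : 11 <= m) (n_ge : 18 * m + 36 <= n).

Let k := m.+2.
Let B1 := itv n 2 k.+1.
Let Z0 := itv n (k+2) (2*k).
Let B2 := pt n 2 :|: Z0.
Let B3 := pt n 3 :|: Z0.

Let n0 : 0 < n. Proof. lia. Qed.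
Let n1 : 1 < n. Proof. lia. Qed.
Let n2 : 2 < n. Proof. lia. Qed.
Let nk : k.+1 < n. Proof. rewrite /k; lia. Qed.
Let o1 := Ordinal n0.
Let o2 := Ordinal n1.
Let o3 := Ordinal n2.
Let ok := Ordinal nk.

Let cB1 : #|B1| = k.
Proof. by rewrite card_itv /k; lia. Qed.

Let cZ0 : #|Z0| = k.-1.
Proof. by rewrite card_itv /k; lia. Qed.

Let cpt a : 0 < a <= n -> #|pt n a| = 1.
Proof. by move=> h; rewrite pt_itv card_itv; lia. Qed.

Let cB2 : #|B2| = k.
Proof.
rewrite cardsU cpt ?cZ0; last lia.
have -> : pt n 2 :&: Z0 = set0 by apply/setP=> i; rewrite !inE /k; lia.
by rewrite cards0 /k; lia.
Qed.

Let cB3 : #|B3| = k.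
Proof.
rewrite cardsU cpt ?cZ0; last lia.
have -> : pt n 3 :&: Z0 = set0 by apply/setP=> i; rewrite !inE /k; lia.
by rewrite cards0 /k; lia.
Qed.

Let memA A : (A \in Afam n k) = [&& #|A| == k, o1 \in A, A :&: B1 != set0,
  A :&: B2 != set0 & A :&: B3 != set0].
Proof.
rewrite inE; congr (_ && _); congr (_ && _).
  have -> : pt n 1 = [set o1] by apply/setP=> i; rewrite !inE -val_eqE.
  by rewrite sub1set.
apply/forallP/and3P => [h|[h1 h2 h3] B].
  by split; [have := h B1|have := h B2|have := h B3]; rewrite !inE !eqxx ?orbT.
by apply/implyP; rewrite !inE => /orP[/orP[]|] /eqP->.
Qed.

Let memB B : (B \in Bfam n k) = [|| B == B1, B == B2 | B == B3].
Proof. by rewrite !inE orbA. Qed.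

Let o1B B : B \in Bfam n k -> o1 \notin B.
Proof. by rewrite memB => /or3P[] /eqP->; rewrite !inE /= /k; lia. Qed.

Let memG A : (A \in Gfam n k) = [&& #|A| == k, o1 \in A, A :&: B1 != set0,
  A :&: B2 != set0 & A :&: B3 != set0] || [|| A == B1, A == B2 | A == B3].
Proof. by rewrite in_setU memA memB. Qed.

Lemma Gfam_uniform : uniform k (Gfam n k).
Proof.
apply/forallP=> A; apply/implyP; rewrite memG.
by case/orP=> [/and5P[]//|/or3P[] /eqP->]; rewrite ?cB1 ?cB2 ?cB3.
Qed.

Lemma Gfam_intersecting : intersecting (Gfam n k).
Proof.
have w2 : o2 \in B1 /\ o2 \in B2 by rewrite !inE /= /k; split; lia.
have w3 : o3 \in B1 /\ o3 \in B3 by rewrite !inE /= /k; split; lia.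
have wk : ok \in B2 /\ ok \in B3 by rewrite !inE /= /k; split; lia.
have int x (A B : {set 'I_n}) : x \in A -> x \in B -> A :&: B != set0.
  by move=> xA xB; apply/set0Pn; exists x; rewrite inE xA.
case: w2 w3 wk => [a1 a2] [b1 b3] [c2 c3].
apply/forallP=> A; apply/implyP=> hA; apply/forallP=> B; apply/implyP.
move: hA; rewrite !memG.
case/orP=> [/and5P[_ hA h1 h2 h3]|hA]; case/orP=> [/and5P[_ hB g1 g2 g3]|hB].
- exact: (int o1).
- by case/or3P: hB => /eqP->.
- by case/or3P: hA => /eqP->; rewrite setIC.
- case/or3P: hA => /eqP->; case/or3P: hB => /eqP->.
  + exact: (int o2).
  + exact: (int o2).
  + exact: (int o3).
  + exact: (int o2).
  + exact: (int o2).
  + exact: (int ok).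
  + exact: (int o3).
  + exact: (int ok).
  + exact: (int o3).
Qed.

Lemma Gfam_no_cover2 : no_cover2 (Gfam n k).
Proof.
move=> p q.
have inB B : [|| B == B1, B == B2 | B == B3] -> B \in Gfam n k.
  by move=> h; rewrite memG h orbT.
have side r : exists X, [/\ X \in Gfam n k, o1 \notin X & r \notin X].
  have [rB|rB1] := boolP (r \in B1); last first.
    by exists B1; split=> //; [apply: inB; rewrite eqxx|apply: o1B; rewrite memB eqxx].
  case: (boolP (r \in B2)) => rB2; last first.
    by exists B2; split=> //; [apply: inB; rewrite eqxx orbT|apply: o1B; rewrite memB eqxx orbT].
  exists B3; split=> //; [by apply: inB; rewrite eqxx !orbT|by apply: o1B; rewrite memB eqxx !orbT|].
  by move: rB rB2; rewrite !inE /k; lia.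
case: (eqVneq p o1) => [->|po]; first exact: side.
case: (eqVneq q o1) => [->|qo]; first by have [X [h1 h2 h3]] := side p; exists X.
have pick (B : {set 'I_n}) : 2 < #|B| -> exists2 x, x \in B & x \notin [set p; q].
  move=> cB; have /set0Pn[x] : B :\: [set p; q] != set0.
    have h : #|B :&: [set p; q]| <= 2.
      by apply: leq_trans (subset_leq_card (subsetIr _ _)) _; rewrite cards2; case: (p != q).
    by rewrite -card_gt0 cardsD subn_gt0; apply: leq_ltn_trans h cB.
  by rewrite inE => /andP[h1 h2]; exists x.
have [y yB yp] : exists2 x, x \in B1 & x \notin [set p; q] by apply: pick; rewrite cB1 /k; lia.
have [z zB zp] : exists2 x, x \in Z0 & x \notin [set p; q] by apply: pick; rewrite cZ0 /k; lia.
have sub : [set o1; y; z] \subset ~: [set p; q].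
  apply/subsetP=> x; rewrite in_setC => /setUP[/setUP[]|] /set1P-> //.
  by rewrite !inE negb_or ![o1 == _]eq_sym po qo.
have c3 : #|[set o1; y; z]| <= k.
  rewrite -setUA; apply: leq_trans (leq_of_leqif (leq_card_setU _ _)) _.
  rewrite cards1 cards2 /k; case: (_ != _) => /=; slia.
have cU : k <= #|~: [set p; q]|.
  have := cardsC [set p; q]; rewrite card_ord cards2 /k; case: (_ != _) => /=; slia.
have [X [sX Xs cX]] := subset_between sub c3 cU.
have o1X : o1 \in X by apply: (subsetP sX); rewrite !inE eqxx.
have yX : y \in X by apply: (subsetP sX); rewrite !inE eqxx orbT.
have zX : z \in X by apply: (subsetP sX); rewrite !inE eqxx orbT.
have out r : r \in [set p; q] -> r \notin X.
  by move=> h; apply/negP=> /(subsetP Xs); rewrite inE h.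
exists X; split; [|by apply: out; rewrite !inE eqxx|by apply: out; rewrite !inE eqxx orbT].
rewrite memG cX eqxx o1X /=; apply/orP; left; apply/and3P.
split; apply/set0Pn; [exists y|exists z|exists z]; rewrite in_setI ?yX ?zX //=.
  by rewrite in_setU zB orbT.
by rewrite in_setU zB orbT.
Qed.

Lemma card_Bfam : #|Bfam n k| = 3.
Proof.
have o2B : o2 \in B2 by rewrite !inE.
have n12 : B1 != B2 by apply/eqP=> /setP/(_ ok); rewrite !inE /= /k; lia.
have n13 : B1 != B3 by apply/eqP=> /setP/(_ ok); rewrite !inE /= /k; lia.
have n23 : B2 != B3 by apply/eqP=> /setP/(_ o2); rewrite !inE /= /k; lia.
by rewrite /Bfam -setUA cardsU1 cards2 n23 !inE negb_or n12 n13.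
Qed.

Lemma card_Afam : #|Afam n k| + 'C(n - k, k.-1) + 'C(n - k - 1, k.-1)
  = 'C(n.-1, k.-1) + 'C(n - 2 * k, k.-1) + 'C(n - k - 2, k - 3).
Proof.
pose U : {set 'I_n} := ~: [set o1].
have cU : #|U| = n.-1 by rewrite cardsC1 card_ord.
have BU : B1 \subset U by apply/subsetP=> i; rewrite !inE -val_eqE /=; lia.
have ZU : Z0 \subset U by apply/subsetP=> i; rewrite !inE -val_eqE /= /k; lia.
pose H := [set Z : {set 'I_n} | [&& Z \subset U, #|Z| == k.-1, Z :&: B1 != set0 & Z :&: Z0 != set0]].
pose S := [set o2; o3].
pose H' := [set Z : {set 'I_n} | [&& S \subset Z, Z \subset U :\: Z0 & #|Z| == k.-1]].
have cBZ : #|B1 :|: Z0| = (2 * k).-1.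
  have -> : B1 :|: Z0 = itv n 2 (2 * k) by apply/setP=> i; rewrite !inE /k; lia.
  by rewrite card_itv /k; lia.
have SU : S \subset U :\: Z0.
  by apply/subsetP=> i; rewrite !inE -!val_eqE /= /k; lia.
have cS : #|S| = 2 by rewrite cards2.
have e1 := card_hits2 k.-1 BU ZU; rewrite -/H in e1.
have Sk : #|S| <= k.-1 by rewrite cS /k; lia.
have e2 := card_supersets SU Sk; rewrite -/H' in e2.
have d : H :&: H' = set0.
  apply/setP=> Z; rewrite !inE; apply/negbTE/negP=> /andP[/and4P[_ _ _ h] /and3P[_]].
  by rewrite subsetD -setI_eq0 (negbTE h) andbF.
have eA : #|Afam n k| = #|H :|: H'|.
  have -> : Afam n k = star o1 (Afam n k).
    apply/setP=> A; rewrite [RHS]inE; case: (boolP (A \in Afam n k)) => //=.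
    by rewrite memA => /and5P[_ ->].
  have dropB (Z B : {set 'I_n}) : o1 \notin B -> (Z :\ o1) :&: B = Z :&: B.
    move=> oB; apply/setP=> x; rewrite !inE.
    by case: (eqVneq x o1) => [->|]; rewrite ?(negbTE oB) ?andbF.
  have o1Z : o1 \notin Z0 by rewrite !inE /= /k; lia.
  have oB1 : o1 \notin B1 by apply: o1B; rewrite memB eqxx.
  have memB2 x : (x \in B2) = (x == o2) || (x \in Z0).
    by rewrite in_setU; congr (_ || _); rewrite !inE -val_eqE.
  have memB3 x : (x \in B3) = (x == o3) || (x \in Z0).
    by rewrite in_setU; congr (_ || _); rewrite !inE -val_eqE.
  rewrite -card_del; apply: eq_card => Z; apply/imsetP/idP.
    case=> A; rewrite inE memA => /andP[/and5P[/eqP cA oA h1 h2 h3] _] ->.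
    have cA' : #|A :\ o1| == k.-1 by move: cA; rewrite (cardsD1 o1) oA => <-.
    have sA : A :\ o1 \subset U.
      by apply/subsetP=> x; rewrite !inE => /andP[].
    rewrite in_setU; apply/orP; case: (eqVneq (A :&: Z0) set0) => [e|h]; last first.
      by left; rewrite inE sA cA' !dropB // h1 h.
    have AZ x : x \in A -> x \in Z0 = false.
      by move=> xA; apply/negP=> xZ; have : x \in A :&: Z0; [rewrite inE xA|rewrite e inE].
    right; rewrite inE cA' andbT subsetD sA -setI_eq0 dropB // e eqxx !andbT.
    rewrite subUset !sub1set !in_setD1.
    have [x /setIP[xA]] := set0Pn _ h2; rewrite memB2 AZ // orbF => /eqP ex.
    have [y /setIP[yA]] := set0Pn _ h3; rewrite memB3 AZ // orbF => /eqP ey.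
    by rewrite -ex -ey xA yA ex ey.
  move=> hZ; have [oZ cZ i1 i2 i3] : [/\ o1 \notin Z, #|Z| = k.-1, Z :&: B1 != set0,
      Z :&: B2 != set0 & Z :&: B3 != set0].
    move: hZ; rewrite in_setU => /orP[]; rewrite inE.
      case/and4P=> [sZ /eqP cZ h1 /set0Pn[x /setIP[xZ xZ0]]].
      split=> //; first by apply/negP=> /(subsetP sZ); rewrite !inE eqxx.
        by apply/set0Pn; exists x; rewrite in_setI xZ memB2 xZ0 orbT.
      by apply/set0Pn; exists x; rewrite in_setI xZ memB3 xZ0 orbT.
    case/and3P; rewrite subUset !sub1set subsetD => /andP[z2 z3] /andP[sZ _] /eqP cZ.
    split=> //; first by apply/negP=> /(subsetP sZ); rewrite !inE eqxx.
    - by apply/set0Pn; exists o2; rewrite in_setI z2 !inE /= /k; lia.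
    - by apply/set0Pn; exists o2; rewrite in_setI z2 memB2 eqxx.
    - by apply/set0Pn; exists o3; rewrite in_setI z3 memB3 eqxx.
  have sub (B : {set 'I_n}) : Z :&: B != set0 -> (o1 |: Z) :&: B != set0.
    case/set0Pn=> x /setIP[xZ xB]; apply/set0Pn; exists x.
    by rewrite in_setI in_setU1 xZ xB orbT.
  exists (o1 |: Z); last by rewrite setU1K.
  by rewrite inE memA cardsU1 oZ cZ in_setU1 eqxx !sub //= ?andbT /k add1n.
have := cardsUI H H'; rewrite d cards0 => eU.
have cUZ : #|U :\: Z0| = n.-1 - k.-1 by rewrite cardsDS // cU cZ0.
rewrite cU cB1 cZ0 cBZ in e1; rewrite cUZ cS in e2.
rewrite eA.
have E1 : n.-1 - k = n - k - 1 by lia.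
have E2 : n.-1 - k.-1 = n - k by rewrite /k; lia.
have E3 : n.-1 - (2 * k).-1 = n - 2 * k by rewrite /k; lia.
have E4 : n.-1 - k.-1 - 2 = n - k - 2 by rewrite /k; lia.
have E5 : k.-1 - 2 = k - 3 by rewrite /k; lia.
rewrite E1 E2 E3 in e1; rewrite E4 E5 in e2.
move: e1 e2 eU; move: (k) => kk; slia.
Qed.

Lemma card_Gfam : #|Gfam n k| = #|Afam n k| + 3.
Proof.
rewrite cardsU card_Bfam (_ : _ :&: _ = set0) ?cards0 ?subn0 //.
apply/setP=> A; rewrite in_setI in_set0; apply/negbTE/negP=> /andP[h1 /o1B].
by move: h1; rewrite memA => /and5P[_ ->].
Qed.
End Gfamily.

Lemma max_bound n m (F : {set {set 'I_n}}) : 11 <= m -> 18 * m.+2 <= n ->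
  uniform m.+2 F -> intersecting F -> 2 < tau F -> #|F| <= #|Gfam n m.+2|.
Proof.
move=> hm hn uF iF tF.
have hn' : 18 * m + 36 <= n by lia.
have uF' : unif m.+2 F by move=> A hA; have /forallP/(_ A) := uF; rewrite hA /= => /eqP.
have cF : cross F F.
  move=> A B hA hB; have /forallP/(_ A) := iF; rewrite hA /= => /forallP/(_ B).
  by rewrite hB.
have := upper_bound hm hn' uF' cF (tau_no_cover2 tF).
have := card_Gfam hm hn'; have := card_Afam hm hn'.
rewrite [m.+2.-1]/=.
have -> : m.+2 - 3 = m.-1 by lia.
have -> : n - m - 3 = n - m.+2 - 1 by lia.
have -> : n - m - 4 = n - m.+2 - 2 by lia.
have e1 : 'C(n - m.+2, m.+1) = 'C(n - m.+2 - 1, m.+1) + 'C(n - m.+2 - 1, m).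
  by rewrite bin_pred ?subn1 //; lia.
have e2 : 'C(n - m.+2 - 1, m) = 'C(n - m.+2 - 2, m) + 'C(n - m.+2 - 2, m.-1).
  have -> : n - m.+2 - 2 = (n - m.+2 - 1).-1 by lia.
  by rewrite bin_pred //; lia.
have e3 : 'C(n - m.+2 - 1, m.+1) = 'C(n - m.+2 - 2, m.+1) + 'C(n - m.+2 - 2, m).
  have -> : n - m.+2 - 2 = (n - m.+2 - 1).-1 by lia.
  by rewrite bin_pred //; lia.
slia.
Qed.

Local Open Scope ring_scope.

Theorem mainTheorem4 (n k : nat) (hk : (13 <= k)%N) (hn : (18 * k <= n)%N) :
  f n k 3 = #|Gfam n k| /\
  (#|Gfam n k| : int) =
    ('C(n.-1, k.-1))%:Z - ('C(n - k, k.-1))%:Z - ('C(n - k - 1, k.-1))%:Z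
    + ('C(n - 2 * k, k.-1))%:Z + ('C(n - k - 2, k - 3))%:Z + 3.
Proof.
have [m km] : exists m, k = m.+2 by exists k.-2; lia.
rewrite km in hk hn *.
have hm : (11 <= m)%N by lia.
have hn' : (18 * m + 36 <= n)%N by lia.
have n1 : (1 < n)%N by lia.
split.
  apply/eqP; rewrite eqn_leq; apply/andP; split.
    by apply/bigmax_leqP=> F /and3P[uF iF tF]; apply: max_bound.
  apply: (@leq_bigmax_cond _ _ (fun F : {set {set 'I_n}} => #|F|)).
  rewrite Gfam_uniform // Gfam_intersecting //=.
  by apply: no_cover2_tau => //; apply: Gfam_no_cover2.
have := card_Gfam hm hn'; have := card_Afam hm hn'; slia.
Qed.
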